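(* There exists an absolute constant $c>0$ such that the following holds. Let $d\ge1$, $\boldsymbol{x}_1\in\mathbb{R}^d$, $\boldsymbol{L}=[L_1,\dots,L_d]$ with all $L_i>0$, $\boldsymbol{\sigma}=[\sigma_1,\dots,\sigma_d]$ with all $\sigma_i\ge0$, and $\Delta_f>0$. There is $T_0$ depending only on $d,\boldsymbol{L},\boldsymbol{\sigma},\Delta_f$ such that for every scaling parameter $\eta>0$ and every integer $T\ge T_0$ there exist a function $f:\mathbb{R}^d\to\mathbb{R}$ and a stochastic gradient oracle for which, running AdaGrad with $\delta=0$ and scaling parameter $\eta$ from $\boldsymbol{x}_1$: (i) $f$ is differentiable, $|f(\boldsymbol{y})-f(\boldsymbol{x})-\langle\nabla f(\boldsymbol{x}),\boldsymbol{y}-\boldsymbol{x}\rangle|\le\sum_{i=1}^d\frac{L_i}{2}|x_i-y_i|^2$ for all $\boldsymbol{x},\boldsymbol{y}\in\mathbb{R}^d$, and $f(\boldsymbol{x}_1)-\inf f\le\Delta_f$; (ii) the stochastic gradients satisfy $\mathbb{E}[\boldsymbol{g}_t\mid\mathcal{F}_{t-1}]=\nabla f(\boldsymbol{x}_t)$ and $\mathbb{E}[|g_{t,i}-\nabla_if(\boldsymbol{x}_t)|^2\mid\mathcal{F}_{t-1}]\le\sigma_i^2$ for all $t$ and all $i\in[d]$; (iii) $$\mathbb{E}\Big[\min_{1\le t\le T}\|\nabla f(\boldsymbol{x}_t)\|_1\Big]\ge c\,\max\bigg\{\sqrt{\frac{\|\boldsymbol{L}\|_1\Delta_f\log T}{T}},\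 \Big(\frac{\big(\sum_{i=1}^d\sigma_i^{2/3}L_i^{1/3}\big)^3\Delta_f\log T}{T}\Big)^{1/4}\bigg\}.$$
   Context: AdaGrad (diagonal) with $\delta=0$ and scaling parameter $\eta>0$: for $t\ge1$ and $i\in[d]$, $x_{t+1,i}=x_{t,i}-\eta\frac{g_{t,i}}{b_{t,i}}$ with $b_{t,i}=\sqrt{\sum_{s=1}^tg_{s,i}^2}$, with the convention that $x_{t+1,i}=x_{t,i}$ if $g_{t,i}=0$ (in particular if $b_{t,i}=0$). A stochastic gradient oracle assigns to each point $\boldsymbol{x}$ a probability distribution on $\mathbb{R}^d$; conditionally on the past $\mathcal{F}_{t-1}$ (the $\sigma$-algebra generated by $\boldsymbol{x}_1,\dots,\boldsymbol{x}_t,\boldsymbol{g}_1,\dots,\boldsymbol{g}_{t-1}$), the stochastic gradient $\boldsymbol{g}_t$ is drawn from the distribution at $\boldsymbol{x}_t$. $\nabla_if$ is the $i$-th partial derivative. *)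

(* Defs.v *)
From HB Require Import structures.
From mathcomp Require Import all_boot all_order all_algebra.
From mathcomp Require Import all_classical all_reals all_analysis.

Set Implicit Arguments.
Unset Strict Implicit.
Unset Printing Implicit Defensive.

Import Order.TTheory GRing.Theory Num.Theory.
Import numFieldNormedType.Exports.

Local Open Scope classical_set_scope.
Local Open Scope ring_scope.

(* Product sigma-algebra on row vectors, as the library does for tuples; for
   real entries it is the Borel sigma-algebra of R^n. *)
Section measurable_rV.
Context {disp : measure_display} {T : sigmaRingType disp} {n : nat}.

Let coord (i : 'I_n) (v : 'rV[T]_n) : T := v ord0 i.

Let rV_set0 : g_sigma_preimage coord set0.
Proof. exact: sigma_algebra0. Qed.

Let rV_setC A : g_sigma_preimage coord A -> g_sigma_preimage coord (~` A).
Proof. exact: sigma_algebraC. Qed.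

Let rV_bigcup (F : (set 'rV[T]_n)^nat) :
  (forall i, g_sigma_preimage coord (F i)) ->
  g_sigma_preimage coord (\bigcup_i F i).
Proof. exact: sigma_algebra_bigcup. Qed.

HB.instance Definition _ := @isMeasurable.Build (measure_tuple_display disp)
  'rV[T]_n (g_sigma_preimage coord) rV_set0 rV_setC rV_bigcup.

End measurable_rV.

Section vectors.
Context {R : realType} {d : nat}.

Definition norm1 (v : 'rV[R]_d) : R := \sum_(i < d) `|v ord0 i|.

Definition partial (f : 'rV[R]_d -> R) (i : 'I_d) (x : 'rV[R]_d) : R :=
  'D_(delta_mx ord0 i) f x.

Definition grad (f : 'rV[R]_d -> R) (x : 'rV[R]_d) : 'rV[R]_d :=
  \row_(i < d) partial f i x.

Definition coordinate_smooth (L : 'rV[R]_d) (f : 'rV[R]_d -> R) : Prop :=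
  forall x y : 'rV[R]_d,
    `|f y - f x - \sum_(i < d) grad f x ord0 i * (y ord0 i - x ord0 i)|
    <= \sum_(i < d) L ord0 i / 2 * `|x ord0 i - y ord0 i| ^+ 2.

(* [inf] is 0 on sets that are not bounded below, hence the first conjunct. *)
Definition initial_gap_le (f : 'rV[R]_d -> R) (x1 : 'rV[R]_d) (Delta : R) :
  Prop := has_lbound (range f) /\ f x1 - inf (range f) <= Delta.

End vectors.

Section conditional_expectation.
Context {disp : measure_display} {Omega : measurableType disp} {R : realType}.
Variable P : probability Omega R.

(* [Y] is a version of the conditional expectation of [X] given the
   sub-sigma-algebra [F]. *)
Definition is_cond_expectation (F : set_system Omega) (X Y : Omega -> R) :
  Prop :=
  [/\ P.-integrable setT (EFin \o X),
      P.-integrable setT (EFin \o Y),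
      forall B : set R, measurable B -> F (Y @^-1` B) &
      forall A : set Omega, F A ->
        (\int[P]_(w in A) (X w)%:E = \int[P]_(w in A) (Y w)%:E)%E].

End conditional_expectation.

(* Time starts at 1: the values [x 0] and [g 0] of the processes below are
   never used. *)
Section adagrad.
Context {R : realType} {d : nat}.

Definition adagrad_denominator (g : nat -> 'rV[R]_d) (t : nat) (i : 'I_d) : R :=
  Num.sqrt (\sum_(1 <= s < t.+1) g s ord0 i ^+ 2).

Definition adagrad_recursion (eta : R) (x1 : 'rV[R]_d)
    (x g : nat -> 'rV[R]_d) : Prop :=
  x 1%N = x1 /\
  forall (t : nat) (i : 'I_d), (1 <= t)%N ->
    x t.+1 ord0 i =
      if g t ord0 i == 0 then x t ord0 i
      else x t ord0 i - eta * (g t ord0 i / adagrad_denominator g t i).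

Context {disp : measure_display} {Omega : measurableType disp}.

(* [history x g t] is F_(t-1), generated by x_1, ..., x_t, g_1, ..., g_(t-1). *)
Definition history (x g : nat -> Omega -> 'rV[R]_d) (t : nat) :
  set_system Omega :=
  <<s (\bigcup_(s in [set s | (1 <= s <= t)%N])
         preimage_set_system setT (x s) measurable) `|`
      (\bigcup_(s in [set s | (1 <= s < t)%N])
         preimage_set_system setT (g s) measurable) >>.

Variable P : probability Omega R.

(* Conditionally on F_(t-1), g_t has law [O (x_t)]: the kernel
   [w |-> O (x t w)] is a regular conditional distribution of [g t]. *)
Definition sampled_from_oracle (O : R.-pker 'rV[R]_d ~> 'rV[R]_d)
    (x g : nat -> Omega -> 'rV[R]_d) : Prop :=
  forall t : nat, (1 <= t)%N ->
    measurable_fun setT (g t) /\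
    forall (A : set Omega) (B : set 'rV[R]_d),
      history x g t A -> measurable B ->
      P (A `&` g t @^-1` B) = (\int[P]_(w in A) O (x t w) B)%E.

Definition adagrad_run (eta : R) (x1 : 'rV[R]_d)
    (O : R.-pker 'rV[R]_d ~> 'rV[R]_d) (x g : nat -> Omega -> 'rV[R]_d) :
  Prop :=
  (forall w : Omega, adagrad_recursion eta x1 (x ^~ w) (g ^~ w)) /\
  sampled_from_oracle O x g.

Definition unbiased_gradients (f : 'rV[R]_d -> R)
    (x g : nat -> Omega -> 'rV[R]_d) : Prop :=
  forall (t : nat) (i : 'I_d), (1 <= t)%N ->
    is_cond_expectation P (history x g t)
      (fun w => g t w ord0 i) (fun w => grad f (x t w) ord0 i).

Definition variance_bounded_gradients (sigma : 'rV[R]_d) (f : 'rV[R]_d -> R)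
    (x g : nat -> Omega -> 'rV[R]_d) : Prop :=
  forall (t : nat) (i : 'I_d), (1 <= t)%N ->
    exists2 V : Omega -> R,
      is_cond_expectation P (history x g t)
        (fun w => `|g t w ord0 i - grad f (x t w) ord0 i| ^+ 2) V &
      {ae P, forall w, V w <= sigma ord0 i ^+ 2}.

(* For [1 <= T], the minimum over 1 <= t <= T (the base value is the term
   t = 1). *)
Definition min_grad_norm1 (f : 'rV[R]_d -> R) (T : nat)
    (x : nat -> 'rV[R]_d) : R :=
  \big[Num.min/norm1 (grad f (x 1%N))]_(1 <= t < T.+1) norm1 (grad f (x t)).

End adagrad.

(* Main.v *)
(* On the k-th step in which coordinate i receives a nonzero stochastic gradient
   of fixed size, AdaGrad moves that coordinate by eta / sqrt k, whatever the
   size.  So the points y_0, y_1, ... that it can visit are known in advance, and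
   the coordinate function f_i with f_i' = - eps_i + L_i * dist(., {y_k}) has slope
   - eps_i at each of them while rising by L_i eta^2 / (4 k) between consecutive
   points.  After n moves f_i has decreased by at most
   2 eps_i eta sqrt n - L_i eta^2 (ln n) / 4, which over all eta is at most of
   order eps_i^2 n / (L_i ln n): this is where the logarithm comes from.  The
   oracle returns - eps_i / p_i with probability p_i and 0 otherwise, with
   p_i = eps_i^2 / sigma_i^2, so that only about p_i T moves are made in T steps;
   p_i = 1 gives the noiseless term of the maximum.  The budget Delta is shared
   among the coordinates in proportion to L_i, resp. sigma_i^(2/3) L_i^(1/3). *)

Require Import Defs.
From HB Require Import structures.
From mathcomp Require Import all_boot all_order all_algebra.
From mathcomp Require Import all_classical all_reals all_analysis.
From mathcomp Require Import measurable_realfun.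
From mathcomp Require Import ring lra.

Import Order.TTheory GRing.Theory Num.Theory.
Import numFieldNormedType.Exports.

Local Open Scope classical_set_scope.
Local Open Scope ring_scope.

(** * One-dimensional smooth functions *)

(** Expectations are therefore computed through the joint law of [x t] and [g t], and the path
    argument is made on the almost sure event where the gradients stay among the oracle's outcomes.
    That runs exist at all is a separate matter, settled on the unit interval.

    The number of moves is random. A pathwise bound linear in the numbers of moves is integrated;
    with allowances N_i at least twice the means it loses half, and it asks for no independence
    between coordinates. So the noisy oracle may hit at most one coordinate at a time, which is
    arranged by p_i <= 1 / d. This and the comparability of ln N_i with ln T, where N_i is about 2
    p_i T, determine T_0.

    The shares D_i of Delta come from an optimization. With noise the constraint is eps_i^4 T /
    sigma_i^2 <= L_i D_i ln T up to a constant, and the sum of the eps_i is largest for D_i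
    proportional to (sigma_i^2 L_i)^(1/3); without noise, eps_i^2 T <= L_i D_i ln T leads to L_i. *)

Section smooth_functions.
Context {R : realType}.
Implicit Types (x y z : R) (n k : nat).

(** Meant for the squared ramp, which is defined by a maximum: a quadratic error bound treats the
    kink of its derivative like any other point. *)
Lemma is_derive_of_quadratic_bound (f : R -> R) (a C x : R) :
  (forall y, `|f y - f x - a * (y - x)| <= C * (y - x) ^+ 2) ->
  is_derive x 1 f a.
Proof.
move=> fC.
suff: h^-1 *: (f (h *: 1 + x) - f x) @[h --> 0^'] --> a.
  move=> fa; apply: DeriveDef; last exact: cvg_lim fa.
  by apply/cvg_ex; exists a.
have C0 : 0 <= C.
  have := fC (x + 1); have -> : x + 1 - x = 1 by ring.
  by rewrite expr1n !mulr1; exact: le_trans.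
apply/cvgrPdist_le => e e0.
have eC : 0 < e / (C + 1) by rewrite divr_gt0// ltr_wpDl.
near=> h.
have h0 : h != 0 by near: h; exact: nbhs_dnbhs_neq.
have he : `|h| <= e / (C + 1).
  near: h; exact: dnbhs0_le.
rewrite /GRing.scale /= mulr1 distrC.
have := fC (h + x); rewrite addrK => H.
have -> : h^-1 * (f (h + x) - f x) - a = h^-1 * (f (h + x) - f x - a * h).
  by field.
rewrite normrM normfV ler_pdivrMl ?normr_gt0//.
apply: (le_trans H).
rewrite -(real_normK (num_real h)) expr2 mulrCA ler_wpM2l//.
rewrite ler_pdivlMr ?ltr_wpDl// in he.
by apply: le_trans he; rewrite mulrC ler_wpM2l// lerDl.
Unshelve. all: by end_near. Qed.

(** Only the side of [x] on which [c] lies is recorded, in one inequality that covers both orders of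
    [x] and [y]. *)
Lemma mean_value (f f' : R -> R) x y :
  (forall z, is_derive z 1 f (f' z)) ->
  exists2 c, 0 <= (c - x) * (y - x) & f y - f x = f' c * (y - x).
Proof.
move=> df.
have cf : continuous f.
  move=> z; apply: differentiable_continuous.
  by apply/derivable1_diffP; case: (df z).
have [xy|yx|<-] := ltgtP x y.
- have [c cxy ->] := MVT xy (fun z _ => df z) (continuous_subspaceT cf).
  exists c => //; rewrite in_itv/= in cxy; case/andP: cxy => ? ?.
  by rewrite mulr_ge0 ?subr_ge0 ?ltW.
- have [c cxy E] := MVT yx (fun z _ => df z) (continuous_subspaceT cf).
  exists c => //; rewrite in_itv/= in cxy.
    by case/andP: cxy => ? ?; rewrite mulr_le0 ?subr_le0 ?ltW.
  by rewrite -opprB E -mulrN opprB.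
- by exists x; rewrite !subrr mulr0.
Qed.

(** Adding s (u - x)^2 to f(u) - f'(x) u with s = L / 2 or s = - L / 2 gives a derivative of
    constant sign on each side of [x], by the Lipschitz bound. The mean value theorem then yields
    the two one-sided estimates without any integral. *)
Lemma quadratic_bound_of_lipschitz_derivative (f f' : R -> R) (L : R) :
  (forall x, is_derive x 1 f (f' x)) ->
  (forall x y, `|f' x - f' y| <= L * `|x - y|) ->
  forall x y, `|f y - f x - f' x * (y - x)| <= L / 2 * `|x - y| ^+ 2.
Proof.
move=> df lf x y.
have der (s : R) z : is_derive z 1
    (fun u => f u - f' x * u + s * (u - x) ^+ 2) (f' z - f' x + s * 2 * (z - x)).
  have := df z => dfz.
  apply: is_derive_eq; rewrite /GRing.scale/=; ring.
rewrite real_normK ?num_real// ler_norml.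
apply/andP; split.
- have [c cx E] := mean_value _ _ x y (der (L / 2)).
  have := lf c x => lc.
  have {}E : f y - f x - f' x * (y - x) + L / 2 * (x - y) ^+ 2 =
     (f' c - f' x + L * (c - x)) * (y - x).
    transitivity ((f' c - f' x + L / 2 * 2 * (c - x)) * (y - x)); last by field.
    rewrite -E; ring.
  suff : 0 <= (f' c - f' x + L * (c - x)) * (y - x) by rewrite -E; lra.
  have [yx|yx|->] := ltgtP y x; last by rewrite subrr mulr0.
    have cx' : c <= x by nra.
    rewrite mulr_le0 ?subr_le0 ?(ltW yx)//.
    move: lc; rewrite [X in _ * X]ler0_norm ?subr_le0// ler_norml => /andP[]; lra.
  have cx' : x <= c by nra.
  rewrite mulr_ge0 ?subr_ge0 ?(ltW yx)//.
  move: lc; rewrite [X in _ * X]ger0_norm ?subr_ge0// ler_norml => /andP[]; lra.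
- have [c cx E] := mean_value _ _ x y (der (- (L / 2))).
  have := lf c x => lc.
  have {}E : f y - f x - f' x * (y - x) - L / 2 * (x - y) ^+ 2 =
     (f' c - f' x - L * (c - x)) * (y - x).
    transitivity ((f' c - f' x + - (L / 2) * 2 * (c - x)) * (y - x)); last by field.
    rewrite -E; ring.
  suff : (f' c - f' x - L * (c - x)) * (y - x) <= 0 by rewrite -E; lra.
  have [yx|yx|->] := ltgtP y x; last by rewrite subrr mulr0.
    have cx' : c <= x by nra.
    rewrite mulr_ge0_le0 ?subr_le0 ?(ltW yx)//.
    move: lc; rewrite [X in _ * X]ler0_norm ?subr_le0// ler_norml => /andP[]; lra.
  have cx' : x <= c by nra.
  rewrite mulr_le0_ge0 ?subr_ge0 ?(ltW yx)//.
  move: lc; rewrite [X in _ * X]ger0_norm ?subr_ge0// ler_norml => /andP[]; lra.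
Qed.

Definition ramp z : R := Num.max z 0.
Definition half_sqr_ramp z : R := ramp z ^+ 2 / 2.

Lemma rampE_ge0 z : 0 <= z -> ramp z = z.
Proof. by move=> z0; rewrite /ramp max_l. Qed.

Lemma rampE_le0 z : z <= 0 -> ramp z = 0.
Proof. by move=> z0; rewrite /ramp max_r. Qed.

Lemma is_derive_half_sqr_ramp (a : R) x :
  is_derive x 1 (fun u => half_sqr_ramp (u - a)) (ramp (x - a)).
Proof.
apply: (@is_derive_of_quadratic_bound _ _ (1 / 2)) => y.
rewrite /half_sqr_ramp /ramp ler_norml.
have -> : y - x = (y - a) - (x - a) by ring.
move: (x - a) (y - a) => X Y.
case: (lerP X 0) => X0; case: (lerP Y 0) => Y0.
- by have H := sqr_ge0 (Y - X); lra.
- have H : 0 <= - X * Y by rewrite mulr_ge0 ?oppr_ge0// ltW.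
  by have H1 := sqr_ge0 X; have H2 := sqr_ge0 Y; have H3 := sqr_ge0 (Y - X); lra.
- have H : 0 <= X * - Y by rewrite mulr_ge0 ?oppr_ge0// ltW.
  by have H1 := sqr_ge0 X; have H2 := sqr_ge0 Y; lra.
- by have H := sqr_ge0 (Y - X); lra.
Qed.

Lemma ramp_lipschitz x y : `|ramp x - ramp y| <= `|x - y|.
Proof.
rewrite /ramp; case: (lerP x 0) => ?; case: (lerP y 0) => ?;
 rewrite ?subrr ?normr0 ?normr_ge0// ler_normr ?ler_norml; lra.
Qed.

End smooth_functions.

(** * Distance to the visited points, and its primitive *)

Section distance_to_points.
Context {R : realType}.
Implicit Types (x z : R) (n k : nat) (y : nat -> R).

(* The distance from [x] to ]-oo, y 0] `|` {y 1, ..., y n}. *)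
Fixpoint tent y n x : R :=
  if n is n'.+1 then Num.min (tent y n' x) `|x - y n| else ramp (x - y 0%N).

(** A new rightmost point folds the last slope 1 down to -1 at the midpoint and back up to 1 at the
    point itself: two kinks of size 2, each integrated to a squared ramp. *)
Fixpoint tent_primitive y n x : R :=
  if n is n'.+1 then
    tent_primitive y n' x - 2 * half_sqr_ramp (x - (y n' + y n) / 2)
      + 2 * half_sqr_ramp (x - y n)
  else half_sqr_ramp (x - y 0%N).

Lemma tent_ge0 y n x : 0 <= tent y n x.
Proof.
by elim: n => [|n IH] /=; rewrite ?le_min ?IH ?normr_ge0// /ramp le_max lexx orbT.
Qed.

Lemma tent_point y n k : (k <= n)%N -> tent y n (y k) = 0.
Proof.
elim: n => [|n IH] /=; first by rewrite leqn0 => /eqP->; rewrite subrr rampE_ge0.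
rewrite leq_eqVlt => /orP[/eqP->|kn].
  by rewrite subrr normr0 min_r ?tent_ge0.
by rewrite IH// min_l.
Qed.

Lemma tent_lipschitz y n x z : `|tent y n x - tent y n z| <= `|x - z|.
Proof.
elim: n => [|n IH] /=.
  apply: le_trans (ramp_lipschitz _ _) _.
  by have -> : x - y 0%N - (z - y 0%N) = x - z by ring.
have H : `| `|x - y n.+1| - `|z - y n.+1| | <= `|x - z|.
  by apply: le_trans (ler_dist_dist _ _) _; rewrite opprB addrA subrK.
move: IH H; move: (tent y n x) (tent y n z) `|x - y n.+1| `|z - y n.+1| => a b c d.
rewrite !ler_norml => /andP[? ?] /andP[? ?].
by case: (leP a c) => ?; case: (leP b d) => ?; apply/andP; split; lra.
Qed.

Lemma tent_le_dist y n x : tent y n x <= `|x - y n|.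
Proof.
case: n => [|n] /=; last by rewrite ge_min lexx orbT.
by rewrite /ramp ge_max ler_norm normr_ge0.
Qed.

Variable y : nat -> R.
Hypothesis y_nondecreasing : forall n, y n <= y n.+1.

Lemma tent_right n x : y n <= x -> tent y n x = x - y n.
Proof.
elim: n x => [|n IH] x /=; first by move=> yx; rewrite rampE_ge0// subr_ge0.
move=> yx; have yn := y_nondecreasing n.
rewrite IH ?(le_trans yn)// ger0_norm ?subr_ge0// min_r// lerD2l lerN2//.
Qed.

Lemma tentS n x :
  tent y n.+1 x =
  tent y n x - 2 * ramp (x - (y n + y n.+1) / 2) + 2 * ramp (x - y n.+1).
Proof.
have yn := y_nondecreasing n; rewrite /=.
have [xm|xm] := leP x ((y n + y n.+1) / 2).
  rewrite !rampE_le0 ?mulr0 ?subr0 ?addr0; [|lra|lra].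
  rewrite min_l// [leRHS]ler0_norm; last by lra.
  apply: le_trans (tent_le_dist _ _ _) _; rewrite ler_norml; lra.
rewrite tent_right; last by lra.
rewrite rampE_ge0; last by lra.
have [xy|xy] := leP x (y n.+1).
  by rewrite rampE_le0 ?ler0_norm ?min_r; lra.
by rewrite rampE_ge0 ?ger0_norm ?min_r; lra.
Qed.

Lemma is_derive_tent_primitive n x :
  is_derive x 1 (tent_primitive y n) (tent y n x).
Proof.
elim: n => [|n IH]; first exact: is_derive_half_sqr_ramp.
rewrite tentS.
have d1 := is_derive_half_sqr_ramp ((y n + y n.+1) / 2) x.
have d2 := is_derive_half_sqr_ramp (y n.+1) x.
by apply: is_derive_eq; rewrite /GRing.scale/=; ring.
Qed.

(** Each gap carries a triangle whose height is half its base, hence of area a quarter of the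
    squared gap; past the last point the slope is 1. *)
Lemma tent_primitive_right n x : y n <= x ->
  tent_primitive y n x =
  \sum_(0 <= k < n) (y k.+1 - y k) ^+ 2 / 4 + (x - y n) ^+ 2 / 2.
Proof.
elim: n x => [|n IH] x /=.
  by move=> yx; rewrite big_nil add0r /half_sqr_ramp rampE_ge0// subr_ge0.
move=> yx; have yn := y_nondecreasing n.
rewrite big_nat_recr//= IH ?(le_trans yn)//.
rewrite /half_sqr_ramp !rampE_ge0; [|lra|lra].
by field.
Qed.

Lemma tent_primitive_left n x : x <= y 0%N -> tent_primitive y n x = 0.
Proof.
elim: n => [|n IH] /= xy.
  by rewrite /half_sqr_ramp rampE_le0 ?subr_le0// expr0n mul0r.
have y0 k : y 0%N <= y k by elim: k => // k /le_trans; apply.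
have y0n := y0 n; have y0n1 := y0 n.+1.
rewrite IH// /half_sqr_ramp !rampE_le0 ?expr0n/=; [lra|lra|lra].
Qed.

(** The values at the points decide: at distance z to the right of the last point passed, the
    primitive has gained at least z^2 / 4, and L z^2 / 4 - eps z >= - eps^2 / L by completing the
    square. *)
Lemma tilted_tent_primitive_ge (eps L C : R) n :
  0 <= eps -> 0 < L ->
  (forall k, (k <= n)%N ->
    - C <= L * (\sum_(0 <= j < k) (y j.+1 - y j) ^+ 2 / 4) - eps * (y k - y 0%N)) ->
  forall x, - (C + eps ^+ 2 / L) <= L * tent_primitive y n x - eps * (x - y 0%N).
Proof.
move=> e0 L0.
have square z : - (eps ^+ 2 / L) <= L * (z ^+ 2 / 4) - eps * z.
  rewrite -subr_ge0; have -> : L * (z ^+ 2 / 4) - eps * z - - (eps ^+ 2 / L) =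
     (L * z / 2 - eps) ^+ 2 / L by field; rewrite gt_eqF.
  by rewrite divr_ge0 ?sqr_ge0 ?ltW.
have square2 z : L * (z ^+ 2 / 4) <= L * (z ^+ 2 / 2).
  by rewrite (ler_wpM2l (ltW L0))//; have := sqr_ge0 z; lra.
elim: n => [|n IH] Ck x.
  have := Ck 0%N isT; rewrite big_nil subrr !mulr0 subrr => C0.
  have [xy|/ltW xy] := leP x (y 0%N).
    rewrite tent_primitive_left// mulr0 add0r.
    have : 0 <= eps ^+ 2 / L by rewrite divr_ge0 ?sqr_ge0 ?ltW.
    have : 0 <= eps * (y 0%N - x) by rewrite mulr_ge0 ?subr_ge0.
    lra.
  rewrite tent_primitive_right// big_nil add0r.
  have := square (x - y 0%N); have := square2 (x - y 0%N); lra.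
have yn := y_nondecreasing n.
have [xy|/ltW xy] := leP (y n.+1) x.
  rewrite tent_primitive_right//.
  have := Ck n.+1 (leqnn _).
  have := square (x - y n.+1); have := square2 (x - y n.+1).
  lra.
rewrite /= [half_sqr_ramp (x - y n.+1)]/half_sqr_ramp rampE_le0 ?subr_le0//.
rewrite expr0n/= mul0r mulr0 addr0.
have {}IH := IH (fun k kn => Ck k (leqW kn)).
have [xm|/ltW xm] := leP x ((y n + y n.+1) / 2).
  by rewrite /half_sqr_ramp rampE_le0 ?subr_le0// expr0n/= mul0r mulr0 subr0.
rewrite tent_primitive_right; last by lra.
have := Ck n (leqnSn _).
have sq := square (x - y n).
(* With z and w the distances to [y n] and [y n.+1], the subtracted term is (z - w)^2 / 4, and 0 <=
   w <= z past the midpoint. *)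
suff : (x - y n) ^+ 2 / 4 <=
    (x - y n) ^+ 2 / 2 - 2 * half_sqr_ramp (x - (y n + y n.+1) / 2).
  rewrite -(ler_pM2l L0); move: sq.
  move: (half_sqr_ramp _) (\sum_(_ <= _ < _) _) => a b; lra.
rewrite /half_sqr_ramp rampE_ge0 ?subr_ge0//.
set z := x - y n; have z0 : 0 <= y n.+1 - x by lra.
set w := y n.+1 - x in z0.
have zw : w <= z by rewrite /z /w; lra.
have -> : x - (y n + y n.+1) / 2 = (z - w) / 2 by rewrite /z /w; field.
have H1 : 0 <= w * (z - w) by rewrite mulr_ge0 ?subr_ge0.
have H2 : 0 <= w * z by rewrite mulr_ge0// (le_trans z0).
lra.
Qed.

End distance_to_points.

(** * The coordinate functions along the path of AdaGrad *)

Section adagrad_path.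
Context {R : realType}.
Implicit Types (x z : R) (n k : nat).

Lemma ln_le_harmonic n : ln n.+1%:R <= \sum_(0 <= j < n) j.+1%:R^-1 :> R.
Proof.
elim: n => [|n IH]; first by rewrite big_nil ln1.
rewrite big_nat_recr//=; apply: le_trans (lerD IH (lexx _)).
have n0 : 0 < n.+1%:R :> R by rewrite ltr0n.
have -> : n.+2%:R = n.+1%:R * (1 + n.+1%:R^-1) :> R.
  by rewrite mulrDr mulr1 divff ?gt_eqF// -natr1.
have n1 : 0 < 1 + n.+1%:R^-1 :> R by rewrite addr_gt0 ?invr_gt0.
rewrite lnM ?posrE//.
by rewrite lerD2l le_ln1Dx// (lt_trans (ltrN10 _))// invr_gt0.
Qed.

Lemma sum_inv_sqrt_le n :
  \sum_(0 <= j < n) (Num.sqrt j.+1%:R)^-1 <= 2 * Num.sqrt n%:R :> R.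
Proof.
elim: n => [|n IH]; first by rewrite big_nil sqrtr0 mulr0.
rewrite big_nat_recr//=; apply: le_trans (lerD IH (lexx _)) _.
set s := Num.sqrt n%:R; set t := Num.sqrt _.
have t0 : 0 < t by rewrite sqrtr_gt0 ltr0n.
have s0 : 0 <= s by exact: sqrtr_ge0.
have ts : t ^+ 2 = s ^+ 2 + 1 by rewrite !sqr_sqrtr ?ler0n// natr1.
rewrite -(ler_pM2r t0) mulrDl mulVf ?gt_eqF//.
have H := sqr_ge0 (t - s); lra.
Qed.

(** The nonnegative terms come before the negative ones, so the partial sums rise and then fall and
    are smallest at one of the two ends. Control at the last point thus gives control at all of
    them. *)
Lemma partial_sum_ge_unimodal (a : nat -> R) n k :
  (forall i j, (i <= j)%N -> 0 <= a j -> 0 <= a i) -> (k <= n)%N ->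
  0 <= \sum_(0 <= j < k) a j \/
  \sum_(0 <= j < n) a j <= \sum_(0 <= j < k) a j.
Proof.
move=> ha kn; have [ak|ak] := leP 0 (a k).
  left; rewrite big_nat; apply: sumr_ge0 => j /andP[_ jk].
  exact: ha (ltnW jk) ak.
right; rewrite (big_cat_nat _ kn)//= gerDl.
rewrite big_nat; apply: sumr_le0 => j /andP[kj _].
rewrite leNgt; apply/negP => /ltW /(ha _ _ kj); by rewrite leNgt ak.
Qed.

Variables (eps L eta x1 : R).

Definition adagrad_point k := x1 + \sum_(0 <= j < k) eta / Num.sqrt j.+1%:R.

(** The index [n] is the number of moves that the function tolerates. Past the point of index [n]
    the slope grows linearly, which keeps the function bounded below. *)
Definition coord_fun n x :=
  L * tent_primitive adagrad_point n x - eps * (x - x1).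

Definition coord_grad n x := L * tent adagrad_point n x - eps.

Lemma adagrad_point0 : adagrad_point 0 = x1.
Proof. by rewrite /adagrad_point big_nil addr0. Qed.

Lemma adagrad_pointS k :
  adagrad_point k.+1 = adagrad_point k + eta / Num.sqrt k.+1%:R.
Proof. by rewrite /adagrad_point big_nat_recr//= addrA. Qed.

Hypotheses (eps0 : 0 <= eps) (L0 : 0 < L) (eta0 : 0 < eta).

Let adagrad_point_nondecreasing k : adagrad_point k <= adagrad_point k.+1.
Proof. by rewrite adagrad_pointS lerDl divr_ge0 ?sqrtr_ge0 ?ltW. Qed.

Lemma coord_grad_point n k : (k <= n)%N -> coord_grad n (adagrad_point k) = - eps.
Proof. by move=> kn; rewrite /coord_grad tent_point// mulr0 sub0r. Qed.

Lemma is_derive_coord_fun n x : is_derive x 1 (coord_fun n) (coord_grad n x).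
Proof.
have d := is_derive_tent_primitive _ adagrad_point_nondecreasing n x.
rewrite /coord_fun /coord_grad.
by apply: is_derive_eq; rewrite /GRing.scale/=; ring.
Qed.

Lemma coord_grad_lipschitz n x z :
  `|coord_grad n x - coord_grad n z| <= L * `|x - z|.
Proof.
rewrite /coord_grad opprB addrA subrK -mulrBr normrM gtr0_norm//.
by rewrite ler_pM2l// tent_lipschitz.
Qed.

Lemma coord_fun_smooth n x z :
  `|coord_fun n z - coord_fun n x - coord_grad n x * (z - x)| <=
  L / 2 * `|x - z| ^+ 2.
Proof.
apply: quadratic_bound_of_lipschitz_derivative.
- exact: is_derive_coord_fun.
- exact: coord_grad_lipschitz.
Qed.

Lemma coord_fun_start n : coord_fun n x1 = 0.
Proof.
by rewrite /coord_fun tent_primitive_left ?adagrad_point0// subrr !mulr0 subrr.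
Qed.

(* The sharp descent bound [L eta^2 ln n / 4 - 2 eps eta sqrt n] is quadratic in
   [eta]; the hypothesis on [eps] makes its discriminant nonpositive, which is
   why one choice of [eps] serves every [eta]. *)
Lemma coord_fun_lower_bound (Delta : R) n x : 0 < Delta -> (0 < n)%N ->
  eps ^+ 2 <= L * Delta * ln n%:R / (8 * n%:R) ->
  - Delta <= coord_fun n x.
Proof.
move=> D0 n0 epsD.
have n0' : 0 < n%:R :> R by rewrite ltr0n.
have ln0 : 0 <= ln n%:R :> R by rewrite ln_ge0// ler1n.
have lnn : ln n%:R <= n%:R :> R by exact/ltW/ln_sublinear.
pose a j := L * ((adagrad_point j.+1 - adagrad_point j) ^+ 2 / 4)
            - eps * (adagrad_point j.+1 - adagrad_point j).
have aE j : a j = (L * eta ^+ 2 / 4) * j.+1%:R^-1 - eps * eta * (Num.sqrt j.+1%:R)^-1.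
  rewrite /a adagrad_pointS addrAC subrr add0r expr_div_n sqr_sqrtr ?ler0n//.
  by ring.
have aE2 j : a j = (Num.sqrt j.+1%:R)^-1 *
    ((L * eta ^+ 2 / 4) * (Num.sqrt j.+1%:R)^-1 - eps * eta).
  have E : j.+1%:R^-1 = (Num.sqrt j.+1%:R)^-1 ^+ 2 :> R by rewrite exprVn sqr_sqrtr ?ler0n.
  by rewrite aE E; ring.
have sumE k : L * (\sum_(0 <= j < k) (adagrad_point j.+1 - adagrad_point j) ^+ 2 / 4)
    - eps * (adagrad_point k - adagrad_point 0) = \sum_(0 <= j < k) a j.
  rewrite -telescope_sumr// !mulr_sumr -sumrB; apply: eq_bigr => j _.
  by rewrite /a.
(* Half of [Delta] pays for the descent at the visited points, the other half for the extra eps^2 /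
   L lost between them. *)
have full : - (Delta / 2) <= \sum_(0 <= j < n) a j.
  under eq_bigr do rewrite aE.
  rewrite sumrB -!mulr_sumr.
  have P0 : 0 <= L * eta ^+ 2 / 4 by rewrite divr_ge0// mulr_ge0 ?sqr_ge0 ?ltW.
  have H1 : (L * eta ^+ 2 / 4) * ln n%:R <=
      (L * eta ^+ 2 / 4) * \sum_(0 <= j < n) j.+1%:R^-1.
    rewrite ler_wpM2l//; apply: le_trans (ln_le_harmonic n).
    by rewrite ler_ln ?posrE ?ltr0n// ler_nat.
  have H2 : eps * eta * (\sum_(0 <= j < n) (Num.sqrt j.+1%:R)^-1) <=
      eps * eta * (2 * Num.sqrt n%:R).
    by rewrite ler_wpM2l ?sum_inv_sqrt_le// mulr_ge0// ltW.
  set r := eps * Num.sqrt n%:R.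
  have r2 : r ^+ 2 <= (L * ln n%:R / 4) * (Delta / 2).
    rewrite /r exprMn sqr_sqrtr ?ler0n//.
    move: epsD; rewrite ler_pdivlMr ?mulr_gt0//; lra.
  (* The factor Delta / 2 turns the discriminant condition [r2] into the square of r * eta - Delta /
     2, with no division by the leading coefficient, which vanishes for [n = 1]. *)
  have : 0 <= (Delta / 2) * ((L * ln n%:R / 4) * eta ^+ 2 - 2 * r * eta + Delta / 2).
    have := sqr_ge0 (r * eta - Delta / 2).
    have : r ^+ 2 * eta ^+ 2 <= (L * ln n%:R / 4) * (Delta / 2) * eta ^+ 2.
      by rewrite ler_wpM2r ?sqr_ge0.
    move: (ln _) => l; rewrite -/r; lra.
  rewrite pmulr_rge0 ?divr_gt0// /r => H3; lra.
have eL : eps ^+ 2 / L <= Delta / 2.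
  rewrite ler_pdivrMr//; apply: le_trans epsD _.
  rewrite ler_pdivrMr ?mulr_gt0//.
  have : L * Delta * ln n%:R <= L * Delta * n%:R by rewrite ler_pM2l ?mulr_gt0.
  have : 0 <= L * Delta * n%:R by rewrite !mulr_ge0 ?ltW.
  lra.
have := @tilted_tent_primitive_ge _ _ adagrad_point_nondecreasing eps L (Delta / 2) n eps0 L0.
move=> /(_ _ x) H; rewrite /coord_fun.
suff : - (Delta / 2 + eps ^+ 2 / L) <=
      L * tent_primitive adagrad_point n x - eps * (x - x1) by lra.
rewrite -adagrad_point0; apply: H => k kn.
rewrite sumE; suff unimodal i j : (i <= j)%N -> 0 <= a j -> 0 <= a i.
  by case: (@partial_sum_ge_unimodal a n k unimodal kn) => H; lra.
(* In the factored form the sign of [a j] is that of a quantity nonincreasing in [j]. *)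
move=> ij; rewrite !aE2.
rewrite !pmulr_rge0 ?invr_gt0 ?sqrtr_gt0 ?ltr0n// !subr_ge0 => /le_trans; apply.
have P0 : 0 <= L * eta ^+ 2 / 4 by rewrite divr_ge0// mulr_ge0 ?sqr_ge0 ?ltW.
by rewrite ler_wpM2l// lef_pV2 ?posrE ?sqrtr_gt0 ?ltr0n// ler_sqrt ?ltr0n// ler_nat ltnS.
Qed.

End adagrad_path.

(** * Separable functions of several variables *)

Section separable_functions.
Context {R : realType} {d : nat}.
Variables (phi phi' : 'I_d -> R -> R).
Hypothesis dphi : forall i (z : R), is_derive z (1 : R) (phi i) (phi' i z).
Implicit Types x y : 'rV[R]_d.

Definition separable x : R := \sum_(i < d) phi i (x ord0 i).

Lemma differentiable_separable x : differentiable separable x.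
Proof.
have -> : separable = \sum_(i < d) (phi i \o (fun x : 'rV[R]_d => x ord0 i)).
  by apply/funext => y; rewrite fct_sumE.
apply: differentiable_sum => i; apply: differentiable_comp.
  exact: differentiable_coord.
by apply/derivable1_diffP; case: (dphi i (x ord0 i)).
Qed.

Lemma partial_separable i x : partial separable i x = phi' i (x ord0 i).
Proof.
case: (dphi i (x ord0 i)) => _ <-; rewrite /partial /derive.
set q := (X in lim (X @ _) = _); set r := (X in _ = lim (X @ _)).
suff -> : q = r by [].
apply/funext => h; rewrite /q /r; congr (_ *: _).
rewrite /separable -sumrB (bigD1 i)//= big1 ?addr0 => [|j ji].
  by rewrite !mxE !eqxx mulr1 /GRing.scale/= mulr1.
by rewrite !mxE eqxx (negPf ji) mulr0 add0r subrr.
Qed.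

Lemma grad_separable i x : grad separable x ord0 i = phi' i (x ord0 i).
Proof. by rewrite mxE partial_separable. Qed.

Lemma separable_smooth (L : 'rV[R]_d) :
  (forall i (a b : R), `|phi i b - phi i a - phi' i a * (b - a)| <=
     L ord0 i / 2 * `|a - b| ^+ 2) ->
  coordinate_smooth L separable.
Proof.
move=> sm x y; rewrite /separable -!sumrB.
apply: le_trans (ler_norm_sum _ _ _) _; apply: ler_sum => i _.
by rewrite grad_separable.
Qed.

Lemma separable_gap (D : 'I_d -> R) (Delta : R) (x1 : 'rV[R]_d) :
  (forall i a, - D i <= phi i a) -> (forall i, phi i (x1 ord0 i) = 0) ->
  \sum_(i < d) D i <= Delta ->
  initial_gap_le separable x1 Delta.
Proof.
move=> lb z DD.
have lb' : lbound (range separable) (- Delta).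
  move=> _ [x _ <-]; apply: (@le_trans _ _ (\sum_(i < d) - D i)).
    by rewrite sumrN lerN2.
  exact: ler_sum.
split; first by exists (- Delta).
rewrite /separable big1 ?sub0r; last by move=> i _; exact: z.
rewrite lerNl; apply: lb_le_inf => //.
by exists (separable x1); exists x1.
Qed.

End separable_functions.

(** * Measurability and finitely supported kernels *)

Section measurable_row_vectors.
Context {disp : measure_display} {T : measurableType disp} {R : realType}.
Context {d : nat}.

Lemma measurable_rV_coord (i : 'I_d) :
  measurable_fun setT (fun v : 'rV[R]_d => v ord0 i).
Proof.
move=> _ Y mY; rewrite setTI; apply: sub_sigma_algebra => /=.
rewrite -bigcup_seq/=; exists i => /=; first by rewrite mem_index_enum.
by exists Y => //; rewrite setTI.
Qed.

Lemma measurable_fun_rV (f : T -> 'rV[R]_d) :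
  (forall i, measurable_fun setT (fun w => f w ord0 i)) -> measurable_fun setT f.
Proof.
move=> mf.
suff : g_sigma_preimage (fun i : 'I_d => (fun v : 'rV[R]_d => v ord0 i) \o f)
         `<=` measurable.
  rewrite g_sigma_preimage_comp => H _ A mA.
  by apply: H; exists A.
apply: smallest_sub; first exact: sigma_algebra_measurable.
rewrite -bigcup_seq; apply: bigcup_sub => i _ A [B mB <-].
exact: mf.
Qed.

End measurable_row_vectors.

Section mixture_kernel.
Context {d1 d2 : measure_display} {X : measurableType d1}.
Context {Y : measurableType d2} {R : realType} {m : nat}.
Variables (w : 'I_m.+1 -> R) (G : 'I_m.+1 -> X -> Y).
Hypotheses (w_ge0 : forall k, 0 <= w k) (w_sum1 : \sum_k w k = 1).
Hypothesis mG : forall k, measurable_fun setT (G k).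

Let nng_weight (k : nat) : {nonneg R} := NngNum (w_ge0 (inord k)).

(** Finite sums of measures are indexed by natural numbers; [inord] turns these into outcomes, which
    is why there are [m.+1] of them. *)
Definition mixture (x : X) : {measure set Y -> \bar R} :=
  msum (fun k => mscale (nng_weight k) (dirac (G (inord k) x))) m.+1.

Lemma mixtureE x B :
  mixture x B = (\sum_(k < m.+1) w k * \1_(G k @^-1` B) x)%:E.
Proof.
rewrite -sumEFin; apply: eq_bigr => k _.
by rewrite /= /mscale/= inord_val diracE indicE EFinM.
Qed.

Let measurable_mixture U : measurable U -> measurable_fun setT (mixture ^~ U : X -> \bar R).
Proof.
move=> mU.
rewrite (_ : (mixture ^~ U : X -> \bar R) =
  EFin \o (fun x => \sum_(k < m.+1) w k * \1_(G k @^-1` U) x)); last first.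
  by apply/funext => x; rewrite mixtureE.
apply/measurable_EFinP; apply: measurable_sum => k.
apply: measurable_funM => //; apply: measurable_indic.
by rewrite -[X in measurable X]setTI; exact: mG.
Qed.

HB.instance Definition _ := isKernel.Build _ _ _ _ _ mixture measurable_mixture.

Let mixture_prob x : mixture x setT = 1%E.
Proof.
rewrite mixtureE -w_sum1; congr _%:E; apply: eq_bigr => k _.
by rewrite indicE in_setT mulr1.
Qed.

HB.instance Definition _ :=
  Kernel_isProbability.Build _ _ _ _ _ mixture mixture_prob.

Definition mixture_kernel : R.-pker X ~> Y := mixture.

End mixture_kernel.

(** * Joint law of a point and its stochastic gradient *)

Section joint_law.
Context {R : realType}.

Lemma ge0_integral_mrestr {d : measure_display} {T : measurableType d}
    (mu : {measure set T -> \bar R}) (A : set T) (mA : measurable A)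
    (f : T -> \bar R) :
  measurable_fun setT f -> (forall t, 0 <= f t)%E ->
  (\int[mrestr mu mA]_t f t = \int[mu]_(t in A) f t)%E.
Proof.
move=> mf f0.
rewrite [LHS](@ge0_negligible_integral _ _ _ _ _ (~` A))//; last 2 first.
- exact: measurableC.
- by rewrite /= /mrestr setICl measure0.
rewrite setTD setCK; apply: eq_measure_integral => B mB BA.
by rewrite /= /mrestr setIidl.
Qed.

Context {disp dX dY : measure_display} {Omega : measurableType disp}.
Context {X : measurableType dX} {Y : measurableType dY}.
Context (P : probability Omega R) {m : nat}.
Variables (w : 'I_m.+1 -> R) (G : 'I_m.+1 -> X -> Y).
Hypotheses (w_ge0 : forall k, 0 <= w k) (w_sum1 : \sum_k w k = 1).
Hypothesis mG : forall k, measurable_fun setT (G k).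
Variables (x : Omega -> X) (g : Omega -> Y).
Hypotheses (mx : measurable_fun setT x) (mg : measurable_fun setT g).
Variable A : set Omega.
Hypothesis mA : measurable A.
Hypothesis law : forall C B, measurable C -> measurable B ->
  P (A `&` (x @^-1` C) `&` (g @^-1` B)) =
  (\sum_k (w k)%:E * P (A `&` (x @^-1` C) `&` ((fun v => G k (x v)) @^-1` B)))%E.

Let mGx k : measurable_fun setT (fun v => G k (x v)).
Proof. exact: measurableT_comp. Qed.

Let nng_weight (k : nat) : {nonneg R} := NngNum (w_ge0 (inord k)).

Let pair_law (h : Omega -> Y) (mh : measurable_fun setT h) :
  {measure set (X * Y) -> \bar R}.
Proof.
refine (pushforward (mrestr P mA) (fun v => (x v, h v))).
exact: measurable_fun_pair.
Defined.

Let mixture_law : {measure set (X * Y) -> \bar R} :=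
  msum (fun k => mscale (nng_weight k) (pair_law _ (mGx (inord k)))) m.+1.

Let mixture_lawE S : mixture_law S = (\sum_k (w k)%:E * pair_law _ (mGx k) S)%E.
Proof.
by rewrite /= /msum; apply: eq_bigr => k _; rewrite /= /mscale /= inord_val.
Qed.

(** The hypothesis [law] fixes both finite measures on rectangles, a pi-system that generates the
    product sigma-algebra. This allows [g] to be replaced by the outcomes [G k \o x] under any
    integral over [A]. *)
Lemma joint_law S : measurable S -> pair_law _ mg S = mixture_law S.
Proof.
apply: (measure_unique [set C `*` B | C in measurable & B in measurable]
          (fun=> setT)).
- exact: measurable_prod_measurableType.
- move=> _ _ [C mC [B mB <-]] [C' mC' [B' mB' <-]].
  exists (C `&` C'); first exact: measurableI.
  by exists (B `&` B'); [exact: measurableI|rewrite setXI].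
- by move=> _; exists setT => //; exists setT => //; rewrite setXTT.
- by rewrite bigcup_const.
- move=> _ [C mC [B mB <-]]; rewrite mixture_lawE.
  have E (h : Omega -> Y) (mh : measurable_fun setT h) :
      pair_law _ mh (C `*` B) = P (A `&` (x @^-1` C) `&` (h @^-1` B)).
    rewrite /= /pushforward /mrestr -setIA setIC; congr (P (_ `&` _)).
  by rewrite E law//; apply: eq_bigr => k _; rewrite E.
- move=> k; rewrite /= /pushforward /mrestr.
  by rewrite preimage_setT setTI; apply: le_lt_trans (ltry 1); exact: probability_le1.
Qed.

Lemma ge0_integral_joint (H : X -> Y -> \bar R) :
  measurable_fun setT (fun z : X * Y => H z.1 z.2) ->
  (forall a b, 0 <= H a b)%E ->
  (\int[P]_(v in A) H (x v) (g v) =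
   \sum_k (w k)%:E * \int[P]_(v in A) H (x v) (G k (x v)))%E.
Proof.
move=> mH H0.
have E (h : Omega -> Y) (mh : measurable_fun setT h) :
    (\int[pair_law _ mh]_z H z.1 z.2 = \int[P]_(v in A) H (x v) (h v))%E.
  have mxh : measurable_fun setT (fun v => (x v, h v)) by exact: measurable_fun_pair.
  rewrite (ge0_integral_pushforward mxh)//= preimage_setT ge0_integral_mrestr//.
  exact: (measurableT_comp mH mxh).
rewrite -E (eq_measure_integral mixture_law); last first.
  by move=> S mS _; exact: joint_law.
rewrite ge0_integral_measure_sum//.
apply: eq_bigr => k _; rewrite ge0_integral_mscale//= inord_val.
by rewrite -E.
Qed.

(** The bound is asked only at the outcomes, since nothing bounds [g] pointwise. Integrability of
    [H (x v) (g v)] therefore comes from the nonnegative case applied to |H|, and the identity from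
    the positive and negative parts. *)
Lemma integral_joint (H : X -> Y -> R) (C : R) :
  measurable_fun setT (fun z : X * Y => H z.1 z.2) ->
  (forall k v, `|H (x v) (G k (x v))| <= C) ->
  P.-integrable A (fun v => (H (x v) (g v))%:E) /\
  (\int[P]_(v in A) (H (x v) (g v))%:E =
   \int[P]_(v in A) (\sum_k w k * H (x v) (G k (x v)))%:E)%E.
Proof.
move=> mH HC.
have mxy (K : X -> Y -> R) h : measurable_fun setT (fun z : X * Y => K z.1 z.2) ->
    measurable_fun setT h -> measurable_fun A (fun v => K (x v) (h v)).
  move=> mK mh; apply: measurable_funTS.
  exact: (measurableT_comp mK (measurable_fun_pair mx mh)).
have PA : (P A < +oo)%E by apply: le_lt_trans (ltry 1); exact: probability_le1.
have intk (K : X -> Y -> R) k : measurable_fun setT (fun z : X * Y => K z.1 z.2) ->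
    (forall v, `|K (x v) (G k (x v))| <= C) ->
    P.-integrable A (fun v => (K (x v) (G k (x v)))%:E).
  move=> mK KC.
  apply: (@measurable_bounded_integrable _ _ _ P (fun v => K (x v) (G k (x v)))) => //.
    exact: mxy.
  exists C; split; first exact: num_real.
  by move=> D CD v _; apply: le_trans (KC v) _; exact: ltW.
have mabs : measurable_fun setT (fun z : X * Y => `|(H z.1 z.2)%:E|%E).
  by apply: measurableT_comp => //; exact/measurable_EFinP.
split.
  apply/integrableP; split; first exact/measurable_EFinP/mxy.
  rewrite (@ge0_integral_joint (fun a b => `|(H a b)%:E|%E))//.
  apply: lte_sum_pinfty => k _; apply: lte_mul_pinfty => //.
    by rewrite lee_fin.
  by case/integrableP : (intk H k mH (HC k)).
pose Hp a b := Num.max (H a b) 0; pose Hn a b := Num.max (- H a b) 0.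
have mHp : measurable_fun setT (fun z : X * Y => Hp z.1 z.2).
  exact: measurable_maxr.
have mHn : measurable_fun setT (fun z : X * Y => Hn z.1 z.2).
  by apply: measurable_maxr => //; exact: measurableT_comp.
have Hp0 a b : 0 <= Hp a b by rewrite le_max lexx orbT.
have Hn0 a b : 0 <= Hn a b by rewrite le_max lexx orbT.
have splitH h : (\int[P]_(v in A) (H (x v) (h v))%:E =
    \int[P]_(v in A) (Hp (x v) (h v))%:E - \int[P]_(v in A) (Hn (x v) (h v))%:E)%E.
  by rewrite integralE; congr (_ - _)%E; apply: eq_integral => v _;
    rewrite ?funeposE ?funenegE EFin_max.
have HpC k v : `|Hp (x v) (G k (x v))| <= C.
  rewrite ger0_norm// ge_max (le_trans (ler_norm _) (HC k v))/=.
  exact: le_trans (HC k v).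
have HnC k v : `|Hn (x v) (G k (x v))| <= C.
  rewrite ger0_norm// ge_max (le_trans _ (HC k v)) ?ler_normr ?lexx ?orbT//=.
  exact: le_trans (HC k v).
transitivity (\sum_k (w k)%:E * \int[P]_(v in A) (H (x v) (G k (x v)))%:E)%E.
  have fp k := integrable_fin_num mA (intk Hp k mHp (HpC k)).
  have fn k := integrable_fin_num mA (intk Hn k mHn (HnC k)).
  rewrite splitH (@ge0_integral_joint (fun a b => (Hp a b)%:E)); last 2 first.
  - exact/measurable_EFinP.
  - by move=> a b; rewrite lee_fin.
  rewrite (@ge0_integral_joint (fun a b => (Hn a b)%:E)); last 2 first.
  - exact/measurable_EFinP.
  - by move=> a b; rewrite lee_fin.
  under [RHS]eq_bigr do rewrite splitH -(fineK (fp _)) -(fineK (fn _)) -EFinB -EFinM mulrBr.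
  under [X in (X - _)%E]eq_bigr => k _ do rewrite -(fineK (fp k)) -EFinM.
  under [X in (_ - X)%E]eq_bigr => k _ do rewrite -(fineK (fn k)) -EFinM.
  by rewrite !sumEFin -EFinB sumrB.
under [RHS]eq_integral do rewrite -sumEFin.
rewrite integral_sum//; last first.
  by move=> k; exact: (integrableZl mA (w k) (intk H k mH (HC k))).
apply: eq_bigr => k _; by rewrite -integralZl//; exact: intk.
Qed.

End joint_law.

(** Serves in both directions: to read the law of a given run off the kernel, and to check that the
    constructed run obeys the kernel. *)
Lemma integral_mixture_weights {R : realType} {disp dX dY : measure_display}
    {Omega : measurableType disp} {X : measurableType dX} {Y : measurableType dY}
    (P : probability Omega R) {m : nat} (w : 'I_m.+1 -> R)
    (G : 'I_m.+1 -> X -> Y) (x : Omega -> X) (D : set Omega) (B : set Y) :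
  (forall k, 0 <= w k) -> (forall k, measurable_fun setT (G k)) ->
  measurable_fun setT x -> measurable D -> measurable B ->
  (\int[P]_(v in D) (\sum_k w k * \1_(G k @^-1` B) (x v))%:E =
   \sum_k (w k)%:E * P (D `&` (fun v => G k (x v)) @^-1` B))%E.
Proof.
move=> w0 mG mx mD mB.
have mk k : measurable ((fun v => G k (x v)) @^-1` B).
  by rewrite -[X in measurable X]setTI; exact: (measurableT_comp (mG k) mx).
under eq_integral do rewrite -sumEFin.
rewrite ge0_integral_sum//; last 2 first.
- move=> k; apply/measurable_EFinP; apply: measurable_funM => //.
  apply: measurable_funTS; exact: (measurable_indic (mk k)).
- by move=> k v _; rewrite lee_fin mulr_ge0.
apply: eq_bigr => k _; under eq_integral do rewrite EFinM.
rewrite ge0_integralZl_EFin//; last first.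
  apply/measurable_EFinP/measurable_funTS; exact: (measurable_indic (mk k)).
congr (_ * _)%E; rewrite [X in _ = P X]setIC.
rewrite -(integral_indic P mD (mk k)).
by apply: eq_integral => v _; rewrite !indicE.
Qed.

(** * Runs of AdaGrad against the oracle *)

Section oracle_run.
Context {R : realType} {d m : nat}.
Variables (eta : R) (x1 : 'rV[R]_d) (psi : 'I_d -> R -> R) (eps M L : 'I_d -> R).
Variables (w : 'I_m.+1 -> R) (xi : 'I_m.+1 -> 'I_d -> bool).
Hypothesis eta_gt0 : 0 < eta.
Hypothesis mpsi : forall i, measurable_fun setT (psi i).
Hypothesis psi_lipschitz : forall i a b, `|psi i a - psi i b| <= L i * `|a - b|.
Hypothesis L_gt0 : forall i, 0 < L i.
Hypotheses (w_ge0 : forall k, 0 <= w k) (w_sum1 : \sum_k w k = 1).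
Hypotheses (eps_ge0 : forall i, 0 <= eps i) (M_ge0 : forall i, 0 <= M i).
Hypothesis mean_xi : forall i, (\sum_k w k * (xi k i)%:R) * M i = eps i.

(* Off the path the oracle is exact, so that the variance bound holds at every
   point. *)
Definition noisy_grad (k : 'I_m.+1) (x : 'rV[R]_d) : 'rV[R]_d :=
  \row_i if psi i (x ord0 i) == - eps i then - (M i * (xi k i)%:R)
         else psi i (x ord0 i).

Lemma measurable_noisy_grad k : measurable_fun setT (noisy_grad k).
Proof.
apply: measurable_fun_rV => i; under eq_fun do rewrite mxE.
have mx : measurable_fun setT (fun x : 'rV[R]_d => psi i (x ord0 i)).
  by apply: measurableT_comp => //; exact: measurable_rV_coord.
by apply: measurable_fun_ifT => //; exact: measurable_fun_eqr.
Qed.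

Lemma noisy_grad_mean i x :
  \sum_k w k * noisy_grad k x ord0 i = psi i (x ord0 i).
Proof.
under eq_bigr do rewrite mxE.
case: eqP => [->|_]; last by rewrite -mulr_suml w_sum1 mul1r.
rewrite -mean_xi mulr_suml -sumrN; apply: eq_bigr => k _; ring.
Qed.

(** On the path the noise is [M i] times a Bernoulli variable, with mean [eps i] in absolute value;
    since an indicator equals its square, its variance is M eps - eps^2. Elsewhere it is 0, hence
    the maximum. *)
Lemma noisy_grad_variance i x :
  \sum_k w k * `|noisy_grad k x ord0 i - psi i (x ord0 i)| ^+ 2 <=
  Num.max 0 (M i * eps i - eps i ^+ 2).
Proof.
under eq_bigr do rewrite mxE real_normK ?num_real//.
case: eqP => [->|_]; last first.
  by rewrite big1 ?le_max ?lexx// => k _; rewrite subrr expr0n mulr0.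
rewrite (_ : \sum_k _ = M i * eps i - eps i ^+ 2) ?le_max ?lexx ?orbT//.
transitivity (\sum_k (M i * (w k * (xi k i)%:R * M i) -
   2 * eps i * (w k * (xi k i)%:R * M i) + eps i ^+ 2 * w k)).
  apply: eq_bigr => k _; case: (xi k i) => /=; ring.
rewrite big_split/= sumrB -!mulr_sumr w_sum1 -mulr_suml mean_xi; ring.
Qed.

Context {disp : measure_display} {Omega : measurableType disp}.
Variables (P : probability Omega R) (O : R.-pker 'rV[R]_d ~> 'rV[R]_d).
Variables (x g : nat -> Omega -> 'rV[R]_d).
Hypothesis OE : forall v B,
  O v B = (\sum_k w k * \1_(noisy_grad k @^-1` B) v)%:E.
Hypothesis run : adagrad_run P eta x1 O x g.

Lemma measurable_run_g t : (1 <= t)%N -> measurable_fun setT (g t).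
Proof. by move=> t1; case: run => _ /(_ t t1) []. Qed.

Lemma run_step t v i : (1 <= t)%N ->
  x t.+1 v ord0 i = if g t v ord0 i == 0 then x t v ord0 i
    else x t v ord0 i - eta * (g t v ord0 i / adagrad_denominator (g ^~ v) t i).
Proof. by move=> t1; case: run => /(_ v) [_ H] _; exact: H. Qed.

Lemma run_start v : x 1 v = x1.
Proof. by case: run => /(_ v) []. Qed.

Lemma measurable_run_x t : (1 <= t)%N -> measurable_fun setT (x t).
Proof.
elim: t => // -[_ _|t IH _].
  by rewrite (_ : x 1 = cst x1)//; apply/funext => v; exact: run_start.
apply: measurable_fun_rV => i.
have mxi : measurable_fun setT (fun v => x t.+1 v ord0 i).
  exact: (measurableT_comp (measurable_rV_coord i) (IH isT)).
have mgi s : (1 <= s)%N -> measurable_fun setT (fun v => g s v ord0 i).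
  by move=> s1; exact: (measurableT_comp (measurable_rV_coord i) (measurable_run_g s s1)).
under eq_fun do rewrite run_step//.
apply: measurable_fun_ifT => //; first by apply: measurable_fun_eqr => //; exact: mgi.
apply: measurable_funB => //; apply: measurable_funM => //.
apply: measurable_funM; first exact: mgi.
rewrite (_ : (fun v => _) = (fun v =>
   ((\sum_(1 <= s < t.+2) g s v ord0 i ^+ 2) `^ (2^-1)) `^ (-1))); last first.
  apply/funext => v; rewrite powR12_sqrt; last by apply: sumr_ge0 => ? _; exact: sqr_ge0.
  by rewrite powR_inv1// sqrtr_ge0.
apply: (measurableT_comp (measurable_powR _)).
apply: (measurableT_comp (measurable_powR _)).
under eq_fun do rewrite big_add1 big_mkord.
by apply: measurable_sum => s; apply: measurable_funX; exact: mgi.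
Qed.

Lemma history_measurable t A : (1 <= t)%N -> history x g t A -> measurable A.
Proof.
move=> t1; apply: smallest_sub; first exact: sigma_algebra_measurable.
rewrite subUset; split; apply: bigcup_sub => s /= /andP[s1 _] _ [B mB <-].
  exact: measurable_run_x.
exact: measurable_run_g.
Qed.

Lemma history_setI t A B :
  history x g t A -> history x g t B -> history x g t (A `&` B).
Proof.
have [_ _ _] := (sigma_algebraP (fun X _ => @subsetT _ X)).1
  (smallest_sigma_algebra setT
  (\bigcup_(s in [set s | (1 <= s <= t)%N])
     preimage_set_system setT (x s) measurable `|`
   \bigcup_(s in [set s | (1 <= s < t)%N])
     preimage_set_system setT (g s) measurable)).
exact.
Qed.

Lemma history_x t C : (1 <= t)%N -> measurable C -> history x g t (x t @^-1` C).
Proof.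
move=> t1 mC; apply: sub_sigma_algebra; left; exists t => /=; first by rewrite t1 leqnn.
by exists C => //; rewrite setTI.
Qed.

(** The square of g_t is among the terms under the root in b_t, so no step exceeds [eta]. The bound
    holds at every sample point and provides the integrability required below. *)
Lemma run_x_bounded t v i : (1 <= t)%N -> `|x t v ord0 i - x1 ord0 i| <= eta * t%:R.
Proof.
elim: t => // -[_ _|t IH _]; first by rewrite run_start subrr normr0 mulr_ge0// ltW.
rewrite run_step//; have {}IH := IH isT.
case: eqP => [_|/eqP g0].
  by apply: le_trans IH _; rewrite ler_pM2l// ler_nat.
rewrite addrAC; apply: le_trans (ler_normB _ _) _.
rewrite -[t.+2%:R]natr1 mulrDr mulr1; apply: lerD => //.
rewrite normrM gtr0_norm// ger_pMr//.
have gd : `|g t.+1 v ord0 i| <= adagrad_denominator (g ^~ v) t.+1 i.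
  rewrite -sqrtr_sqr /adagrad_denominator ler_sqrt; last first.
    by apply: sumr_ge0 => ? _; exact: sqr_ge0.
  rewrite big_nat_recr//= lerDr; apply: sumr_ge0 => ? _; exact: sqr_ge0.
have d0 : 0 < adagrad_denominator (g ^~ v) t.+1 i.
  by apply: lt_le_trans gd; rewrite normr_gt0.
by rewrite normrM normfV ler_pdivrMr ?normr_gt0 ?gt_eqF// mul1r (gtr0_norm d0).
Qed.

Lemma run_psi_bounded t : (1 <= t)%N ->
  exists C, forall v i, `|psi i (x t v ord0 i)| <= C.
Proof.
move=> t1; exists (\sum_i (`|psi i (x1 ord0 i)| + L i * (eta * t%:R))) => v i.
rewrite (bigD1 i)//= ler_wpDr//.
  apply: sumr_ge0 => j _; rewrite addr_ge0// mulr_ge0 ?(ltW (L_gt0 _))//.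
  by rewrite mulr_ge0// ltW.
rewrite -lerBlDl; apply: le_trans (lerB_dist _ _) _.
apply: le_trans (psi_lipschitz _ _ _) _; rewrite ler_pM2l//.
exact: run_x_bounded.
Qed.

Lemma run_outcome_bounded t : (1 <= t)%N ->
  exists C, forall k v i, `|noisy_grad k (x t v) ord0 i| <= C.
Proof.
move=> t1; have [C HC] := run_psi_bounded t t1.
exists (C + \sum_i M i) => k v i; rewrite mxE.
have C0 : 0 <= C by apply: le_trans (HC v i).
have MS : M i <= \sum_j M j by rewrite (bigD1 i)//= lerDl sumr_ge0.
case: eqP => _; last by apply: le_trans (HC v i) _; rewrite lerDl sumr_ge0.
rewrite normrN ger0_norm ?mulr_ge0 ?ler0n//.
by have M0 := M_ge0 i; case: (xi k i); rewrite ?mulr1 ?mulr0; lra.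
Qed.

(** The event that [x t] lies in [C] belongs to the history, so the sampling identity applies to its
    intersection with [A]. This is the hypothesis needed for the joint law. *)
Lemma run_law t A C B : (1 <= t)%N -> history x g t A ->
  measurable C -> measurable B ->
  P (A `&` x t @^-1` C `&` g t @^-1` B) =
  (\sum_k (w k)%:E *
     P (A `&` x t @^-1` C `&` (fun v => noisy_grad k (x t v)) @^-1` B))%E.
Proof.
move=> t1 hA mC mB.
have hD := history_setI _ _ _ hA (history_x _ _ t1 mC).
have mD := history_measurable _ _ t1 hD.
move: run => [_ /(_ t t1) [_ /(_ _ _ hD mB) ->]].
under eq_integral do rewrite OE.
apply: integral_mixture_weights => //; first exact: measurable_noisy_grad.
exact: measurable_run_x.
Qed.

Lemma run_unbiased t i : (1 <= t)%N ->
  is_cond_expectation P (history x g t)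
    (fun v => g t v ord0 i) (fun v => psi i (x t v ord0 i)).
Proof.
move=> t1; have [C HC] := run_outcome_bounded t t1.
have [C' HC'] := run_psi_bounded t t1.
have J A (hA : history x g t A) := integral_joint P w noisy_grad w_ge0
   measurable_noisy_grad (x t) (g t) (measurable_run_x t t1) (measurable_run_g t t1)
   A (history_measurable t A t1 hA) (fun C B => run_law t A C B t1 hA)
   (fun _ b => b ord0 i) C.
have mH : measurable_fun setT (fun z : 'rV[R]_d * 'rV[R]_d => z.2 ord0 i).
  exact: (measurableT_comp (measurable_rV_coord i) measurable_snd).
have mpx : measurable_fun setT (fun v => psi i (x t v ord0 i)).
  apply: (measurableT_comp (mpsi i)).
  exact: (measurableT_comp (measurable_rV_coord i) (measurable_run_x t t1)).
split.
- have hT : history x g t setT by rewrite -(preimage_setT (x t)); exact: history_x.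
  by have [] := J setT hT mH (fun k v => HC k v i).
- apply: (@measurable_bounded_integrable _ _ _ P (fun v => psi i (x t v ord0 i))) => //.
    by apply: le_lt_trans (ltry 1); exact: probability_le1.
  exists C'; split; first exact: num_real.
  by move=> D CD v _; apply: le_trans (HC' v i) _; exact: ltW.
- move=> B mB; apply: (history_x t ((fun a : 'rV[R]_d => psi i (a ord0 i)) @^-1` B) t1).
  rewrite -[X in measurable X]setTI.
  exact: (measurableT_comp (mpsi i) (measurable_rV_coord i)).
- move=> A hA; have [_ ->] := J A hA mH (fun k v => HC k v i).
  by apply: eq_integral => v _; rewrite noisy_grad_mean.
Qed.

Lemma run_variance t i (s : R) : (1 <= t)%N -> 0 <= s ->
  M i * eps i - eps i ^+ 2 <= s ->
  exists2 V : Omega -> R,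
    is_cond_expectation P (history x g t)
      (fun v => `|g t v ord0 i - psi i (x t v ord0 i)| ^+ 2) V &
    {ae P, forall v, V v <= s}.
Proof.
move=> t1 s0 Ms; have [C HC] := run_outcome_bounded t t1.
have [C' HC'] := run_psi_bounded t t1.
have J A (hA : history x g t A) := integral_joint P w noisy_grad w_ge0
   measurable_noisy_grad (x t) (g t) (measurable_run_x t t1) (measurable_run_g t t1)
   A (history_measurable t A t1 hA) (fun C B => run_law t A C B t1 hA)
   (fun a b => `|b ord0 i - psi i (a ord0 i)| ^+ 2) ((C + C') ^+ 2).
have mH : measurable_fun setT (fun z : 'rV[R]_d * 'rV[R]_d =>
    `|z.2 ord0 i - psi i (z.1 ord0 i)| ^+ 2).
  apply: measurable_funX; apply: measurableT_comp => //; apply: measurable_funB.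
    exact: (measurableT_comp (measurable_rV_coord i) measurable_snd).
  apply: (measurableT_comp (mpsi i)).
  exact: (measurableT_comp (measurable_rV_coord i) measurable_fst).
have HB k v : `| `|noisy_grad k (x t v) ord0 i - psi i (x t v ord0 i)| ^+ 2 | <=
    (C + C') ^+ 2.
  rewrite ger0_norm ?exprn_ge0// lerXn2r ?nnegrE//.
    by rewrite (le_trans (normr_ge0 (noisy_grad k (x t v) ord0 i + psi i (x t v ord0 i))))//
      (le_trans (ler_normD _ _))// lerD.
  by apply: le_trans (ler_normB _ _) _; rewrite lerD.
(* The variance of the oracle at a point; composed with [x t], it is the version of the conditional
   variance. *)
pose W (a : 'rV[R]_d) := \sum_k w k * `|noisy_grad k a ord0 i - psi i (a ord0 i)| ^+ 2.
have W0 a : 0 <= W a by apply: sumr_ge0 => k _; rewrite mulr_ge0// exprn_ge0.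
have Ws a : W a <= s.
  by apply: le_trans (noisy_grad_variance i a) _; rewrite ge_max s0.
have mW : measurable_fun setT W.
  apply: measurable_sum => k; apply: measurable_funM => //.
  apply: measurable_funX; apply: measurableT_comp => //; apply: measurable_funB.
    exact: (measurableT_comp (measurable_rV_coord i) (measurable_noisy_grad k)).
  exact: (measurableT_comp (mpsi i) (measurable_rV_coord i)).
exists (W \o x t); last by apply: aeW => v; exact: Ws.
split.
- have hT : history x g t setT by rewrite -(preimage_setT (x t)); exact: history_x.
  by have [] := J setT hT mH HB.
- apply: (@measurable_bounded_integrable _ _ _ P (W \o x t)) => //.
  + by apply: le_lt_trans (ltry 1); exact: probability_le1.
  + exact: (measurableT_comp mW (measurable_run_x t t1)).
  exists s; split; first exact: num_real.
  by move=> D CD v _ /=; rewrite ger0_norm//; apply: le_trans (Ws _) _; exact: ltW.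
- move=> B mB; rewrite comp_preimage; apply: (history_x t _ t1).
  by rewrite -[X in measurable X]setTI; exact: mW.
- by move=> A hA; have [_ ->] := J A hA mH HB.
Qed.

(** * Counting the moves of a run *)

Variable N : 'I_d -> nat.
Hypothesis psi_point : forall i k, (k <= N i)%N ->
  psi i (adagrad_point eta (x1 ord0 i) k) = - eps i.

(** The test is on the slope and not on the position, as in [noisy_grad]: wherever it succeeds, each
    outcome is 0 or [- M i]. *)
Definition on_path t i v := psi i (x t v ord0 i) == - eps i.
Definition moves t i v : bool := on_path t i v && (g t v ord0 i != 0).
Definition num_moves t i v : nat := \sum_(1 <= s < t) moves s i v.
(** In an arbitrary run [g t] has the law of the oracle but may leave its support on a null set;
    this is the property that excludes such sample points. *)
Definition faithful t i v :=
  on_path t i v -> g t v ord0 i = 0 \/ g t v ord0 i = - M i.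

Let path_set i : set 'rV[R]_d := [set a | psi i (a ord0 i) == - eps i].

Let measurable_path_set i : measurable (path_set i).
Proof.
have mp : measurable_fun setT (fun a : 'rV[R]_d => psi i (a ord0 i) == - eps i).
  apply: measurable_fun_eqr => //.
  exact: (measurableT_comp (mpsi i) (measurable_rV_coord i)).
rewrite -[X in measurable X]setTI.
exact: (mp measurableT [set true] I).
Qed.

Let measurable_coord_in i (B : set R) : measurable B ->
  measurable [set b : 'rV[R]_d | B (b ord0 i)].
Proof.
move=> mB; rewrite -[X in measurable X]setTI.
exact: (measurable_rV_coord i measurableT B mB).
Qed.

Let history_T t : (1 <= t)%N -> history x g t setT.
Proof. by move=> t1; rewrite -(preimage_setT (x t)); exact: history_x. Qed.

(** By [run_law], the event of leaving the support has a probability that is a weighted sum over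
    outcomes, and each of them contributes an empty event. *)
Lemma ae_faithful t i : (1 <= t)%N -> {ae P, forall v, faithful t i v}.
Proof.
move=> t1; pose B := ~` [set 0; - M i].
have mB : measurable B by apply: measurableC; apply: measurableU.
have := run_law t setT _ _ t1 (history_T t t1) (measurable_path_set i)
  (measurable_coord_in i B mB).
rewrite [RHS]big1; last first.
  move=> k _; rewrite (_ : _ `&` _ = set0) ?measure0 ?mule0//.
  rewrite -subset0 => v [[_ /= /eqP ps]]; rewrite mxE ps eqxx; apply.
  by case: (xi k i); [right; rewrite mulr1|left; rewrite mulr0 oppr0].
set S := (X in P X = _) => PS.
exists S; split => //.
- rewrite /S; apply: measurableI; last first.
    rewrite -[X in measurable X]setTI.
    exact: (measurable_run_g t t1 measurableT _ (measurable_coord_in i B mB)).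
  apply: measurableI => //; rewrite -[X in measurable X]setTI.
  exact: (measurable_run_x t t1 measurableT _ (measurable_path_set i)).
- move=> v /= nf; split.
    split => //=; apply/negP => /negP op; apply: nf => op'.
    by rewrite -/(on_path t i v) op' in op.
  by move=> /= H; apply: nf => _.
Qed.

Let move_set t i : set Omega :=
  setT `&` x t @^-1` (path_set i) `&` g t @^-1` [set b | (~` [set 0]) (b ord0 i)].

Let measurable_move_set t i : (1 <= t)%N -> measurable (move_set t i).
Proof.
move=> t1; apply: measurableI; last first.
  rewrite -[X in measurable X]setTI.
  apply: (measurable_run_g t t1 measurableT _ (measurable_coord_in i _ _)).
  exact: measurableC.
apply: measurableI => //; rewrite -[X in measurable X]setTI.
exact: (measurable_run_x t t1 measurableT _ (measurable_path_set i)).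
Qed.

Let movesE t i v : (moves t i v)%:R = \1_(move_set t i) v :> R.
Proof.
rewrite indicE; congr (_%:R); congr nat_of_bool; apply/idP/idP.
  by move=> /andP[H1 H2]; apply/mem_set; split => //=; apply/eqP.
by move=> /set_mem [[_ /= H1] /= H2]; apply/andP; split => //; apply/eqP.
Qed.

Lemma move_probability t i : (1 <= t)%N ->
  (P (move_set t i) <= (\sum_k w k * (xi k i)%:R)%:E)%E.
Proof.
move=> t1; have m0 : measurable (~` [set 0 : R]) by exact: measurableC.
rewrite /move_set (run_law t setT _ _ t1 (history_T t t1)
  (measurable_path_set i) (measurable_coord_in i _ m0)).
rewrite -sumEFin; apply: lee_sum => k _; rewrite EFinM; apply: lee_wpmul2l.
  by rewrite lee_fin.
case xik : (xi k i).
  apply: probability_le1; apply: measurableI.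
    apply: measurableI => //; rewrite -[X in measurable X]setTI.
    exact: (measurable_run_x t t1 measurableT _ (measurable_path_set i)).
  rewrite -[X in measurable X]setTI.
  have mk : measurable_fun setT (fun v => noisy_grad k (x t v)).
    exact: (measurableT_comp (measurable_noisy_grad k) (measurable_run_x t t1)).
  exact: (mk measurableT _ (measurable_coord_in i _ m0)).
rewrite (_ : _ `&` _ = set0) ?measure0//.
rewrite -subset0 => v [[_ /= /eqP ps]]; rewrite mxE ps eqxx; apply.
by rewrite xik mulr0 oppr0.
Qed.

(** All nonzero gradients received so far equal [- M i], so b_t is M sqrt k at the k-th move and M
    cancels. The accumulated squares are part of the conclusion because the next step depends on
    them; the allowance [N i] keeps the coordinate among the points of slope [- eps i]. *)
Lemma run_path T t i v : (forall s, (1 <= s <= T)%N -> faithful s i v) ->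
  (1 <= t <= T.+1)%N -> (num_moves t i v <= N i)%N ->
  x t v ord0 i = adagrad_point eta (x1 ord0 i) (num_moves t i v) /\
  \sum_(1 <= s < t) g s v ord0 i ^+ 2 = (num_moves t i v)%:R * M i ^+ 2.
Proof.
move=> faith; elim: t => // -[_ _ _|t IH].
  by rewrite /num_moves !big_geq// adagrad_point0 run_start mul0r.
rewrite ltnS => /andP[_ tT].
have nS : num_moves t.+2 i v = (num_moves t.+1 i v + moves t.+1 i v)%N.
  by rewrite /num_moves big_nat_recr.
rewrite nS => nN.
have nN' : (num_moves t.+1 i v <= N i)%N by apply: leq_trans nN; exact: leq_addr.
have [xE gE] := IH (ltnW tT) nN'.
have op : on_path t.+1 i v by rewrite /on_path xE psi_point.
rewrite big_nat_recr//= gE run_step//.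
have [g0|gM] := faith t.+1 tT op.
  by rewrite /moves g0 eqxx andbF addn0 expr0n addr0.
have [g0|g0] := eqVneq (g t.+1 v ord0 i) 0.
  by rewrite /moves g0 eqxx andbF addn0 expr0n addr0.
rewrite /moves op g0 /= addn1 adagrad_pointS xE gM sqrrN; split; last first.
  by rewrite -natr1 mulrDl mul1r.
have M0 : 0 < M i.
  by rewrite lt_def M_ge0 andbT; apply: contraNneq g0 => M0; rewrite gM M0 oppr0.
rewrite /adagrad_denominator big_nat_recr//= gE gM sqrrN.
have -> : (num_moves t.+1 i v)%:R * M i ^+ 2 + M i ^+ 2 =
    (num_moves t.+1 i v).+1%:R * M i ^+ 2 by rewrite -natr1; ring.
rewrite sqrtrM ?ler0n// sqrtr_sqr gtr0_norm//.
have s0 : Num.sqrt (num_moves t.+1 i v).+1%:R != 0 :> R.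
  by rewrite sqrtr_eq0 -ltNge ltr0n.
have Mn0 : M i != 0 by rewrite gt_eqF.
by field; rewrite ?s0 ?Mn0.
Qed.

Variable f : 'rV[R]_d -> R.
Hypothesis gradE : forall a i, grad f a ord0 i = psi i (a ord0 i).

(** A coordinate within its allowance contributes [eps i] to the norm at every time up to [T]; for
    one beyond it, the claimed contribution eps - (eps / N) * moves is negative and hence
    harmless. *)
Lemma min_grad_norm1_ge T v : (1 <= T)%N -> (forall i, (0 < N i)%N) ->
  (forall i s, (1 <= s <= T)%N -> faithful s i v) ->
  \sum_i eps i <= min_grad_norm1 f T (x ^~ v) +
    \sum_i eps i / (N i)%:R * (num_moves T.+1 i v)%:R.
Proof.
move=> T1 N0 faith; rewrite -lerBlDr -sumrB.
have norm_ge t : (1 <= t <= T)%N ->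
    \sum_i (eps i - eps i / (N i)%:R * (num_moves T.+1 i v)%:R) <= norm1 (grad f (x t v)).
  move=> /andP[t1 tT]; apply: ler_sum => i _; rewrite gradE.
  have N0' : 0 < (N i)%:R :> R by rewrite ltr0n.
  have [le|lt] := leqP (num_moves T.+1 i v) (N i).
    have le' : (num_moves t i v <= N i)%N.
      apply: leq_trans le; rewrite /num_moves (@big_cat_nat _ _ _ t 1 T.+1)//=.
        exact: leq_addr.
      exact: leqW.
    have [|-> _] := run_path T t i v (faith i) _ le'; first by rewrite t1 ltnW.
    rewrite psi_point// normrN ger0_norm// gerBl mulr_ge0// divr_ge0//.
  apply: le_trans (normr_ge0 _); rewrite subr_le0 mulrAC -mulrA.
  by rewrite ler_peMr// ler_pdivlMr// mul1r ler_nat ltnW.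
rewrite /min_grad_norm1 big_nat; apply: le_bigmin => [|t t1T].
  by apply: norm_ge; rewrite T1.
exact: norm_ge.
Qed.

Let norm1_ge0 (a : 'rV[R]_d) : 0 <= norm1 a.
Proof. by apply: sumr_ge0 => i _. Qed.

Lemma measurable_min_grad_norm1 T :
  measurable_fun setT (fun v => min_grad_norm1 f T (x ^~ v)).
Proof.
have mF t : measurable_fun setT (fun v => norm1 (grad f (x t.+1 v))).
  apply: measurable_sum => i; apply: measurableT_comp => //.
  under eq_fun do rewrite gradE; apply: (measurableT_comp (mpsi i)).
  exact: (measurableT_comp (measurable_rV_coord i) (measurable_run_x t.+1 isT)).
rewrite /min_grad_norm1; under eq_fun do rewrite big_add1.
elim: (index_iota 0 T.+1.-1) => [|t s IH].
  by under eq_fun do rewrite big_nil; exact: mF.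
by under eq_fun do rewrite big_cons; exact: measurable_minr.
Qed.

Let num_movesE T i v : (num_moves T.+1 i v)%:R = \sum_(s < T) \1_(move_set s.+1 i) v :> R.
Proof.
rewrite /num_moves big_add1 big_mkord natr_sum; apply: eq_bigr => s _.
exact: movesE.
Qed.

Let measurable_num_moves T i :
  measurable_fun setT (fun v => (num_moves T.+1 i v)%:R : R).
Proof.
under eq_fun do rewrite num_movesE; apply: measurable_sum => s.
exact: (measurable_indic (measurable_move_set s.+1 i isT)).
Qed.

Lemma expected_num_moves T i :
  (\int[P]_v ((num_moves T.+1 i v)%:R)%:E <=
   (T%:R * \sum_k w k * (xi k i)%:R)%:E)%E.
Proof.
under eq_integral do rewrite num_movesE -sumEFin.
rewrite ge0_integral_sum//; last first.
  move=> s; apply/measurable_EFinP.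
  exact: (measurable_indic (measurable_move_set s.+1 i isT)).
rewrite -[T in T%:R]card_ord mulr_natl -sumr_const -sumEFin.
apply: lee_sum => s _.
rewrite (integral_indic P measurableT (measurable_move_set s.+1 i isT)) setIT.
exact: move_probability.
Qed.

(* The pathwise inequality [\sum eps <= min + \sum (eps / N) * moves] turns the
   lower bound into an upper bound on the expected number of moves. *)
Lemma expected_min_grad_norm1_ge T : (1 <= T)%N -> (forall i, (0 < N i)%N) ->
  (forall i, 2 * (\sum_k w k * (xi k i)%:R) * T%:R <= (N i)%:R) ->
  ((2^-1 * \sum_i eps i)%:E <= 'E_P[fun v => min_grad_norm1 f T (x ^~ v)])%E.
Proof.
move=> T1 N0 pN; rewrite [in leRHS]unlock.
pose X v := min_grad_norm1 f T (x ^~ v).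
pose Z v := \sum_i eps i / (N i)%:R * (num_moves T.+1 i v)%:R.
have X0 v : 0 <= X v by apply: le_bigmin => // t _; exact: norm1_ge0.
have c0 i : 0 <= eps i / (N i)%:R by rewrite divr_ge0.
have Z0 v : 0 <= Z v by apply: sumr_ge0 => i _; rewrite mulr_ge0.
have mX := measurable_min_grad_norm1 T.
have mZ : measurable_fun setT Z.
  by apply: measurable_sum => i; apply: measurable_funM.
(* Since [N i] is at least twice the expected number of moves, each coordinate loses at most half of
   [eps i]. *)
have IZ : (\int[P]_v (Z v)%:E <= (2^-1 * \sum_i eps i)%:E)%E.
  under eq_integral do rewrite -sumEFin.
  rewrite ge0_integral_sum//; last 2 first.
  - by move=> i; apply/measurable_EFinP; apply: measurable_funM.
  - by move=> i v _; rewrite lee_fin mulr_ge0.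
  rewrite mulr_sumr -sumEFin; apply: lee_sum => i _.
  under eq_integral do rewrite EFinM.
  rewrite ge0_integralZl_EFin//; last exact/measurable_EFinP.
  apply: (@le_trans _ _ ((eps i / (N i)%:R)%:E * (T%:R * \sum_k w k * (xi k i)%:R)%:E)%E).
    by apply: lee_wpmul2l; [rewrite lee_fin|exact: expected_num_moves].
  rewrite -EFinM lee_fin mulrAC ler_pdivrMr ?ltr0n// mulrAC [leRHS]mulrC.
  rewrite ler_wpM2l//; have := pN i; lra.
have ae_bound : {ae P, forall v, setT v -> ((\sum_i eps i)%:E <= (X v)%:E + (Z v)%:E)%E}.
  have faith : {ae P, forall v, forall s i, faithful s.+1 i v}.
    by apply: ae_foralln => s; apply: filter_forall => i; exact: ae_faithful.
  apply: filterS faith => v faith _; rewrite -EFinD lee_fin.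
  by apply: min_grad_norm1_ge => // i [|s] //.
have := ae_ge0_le_integral measurableT _ _ _ _ ae_bound.
have -> : (\int[P]__ (\sum_i eps i)%:E = (\sum_i eps i)%:E)%E.
  by rewrite integral_cst//= probability_setT mule1.
have mXE : measurable_fun setT (EFin \o X) by exact/measurable_EFinP.
have mZE : measurable_fun setT (EFin \o Z) by exact/measurable_EFinP.
rewrite ge0_integralD//; last 2 first.
- by move=> v _; rewrite lee_fin.
- by move=> v _; rewrite lee_fin.
move=> H.
have {}H : ((\sum_i eps i)%:E <= \int[P]_v (X v)%:E + (2^-1 * \sum_i eps i)%:E)%E.
  apply: (le_trans (H _ _ _ _)).
  - by move=> v _; rewrite lee_fin sumr_ge0.
  - by [].
  - by move=> v _; rewrite -EFinD lee_fin addr_ge0.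
  - exact: emeasurable_funD.
  - by rewrite leeD2l.
move: H; rewrite -leeBlDr// -EFinB; apply: le_trans.
rewrite lee_fin; lra.
Qed.

End oracle_run.

(** * Existence of a run *)

Section iterated_digits.
Context {R : realType} {disp : measure_display} {Omega : measurableType disp}.
Context (P : probability Omega R) {m : nat}.
Variables (w : 'I_m.+1 -> R) (kappa : Omega -> 'I_m.+1) (tau : Omega -> Omega).
Hypothesis mkappa : forall k, measurable (kappa @^-1` [set k]).
Hypothesis mtau : measurable_fun setT tau.
Hypothesis renewal : forall k B, measurable B ->
  P (kappa @^-1` [set k] `&` tau @^-1` B) = ((w k)%:E * P B)%E.

Let split_fibers (h : Omega -> 'I_m.+1) (A : set Omega) :
  A = \big[setU/set0]_(k < m.+1) (A `&` h @^-1` [set k]).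
Proof.
rewrite -bigcup_mkord_ord; apply/seteqP; split => [u Au|u [k _ []]//].
exists (h u) => //=; split => //.
by apply/val_inj; rewrite /= inordK.
Qed.

Lemma probability_fibers (h : Omega -> 'I_m.+1) (A : set Omega) :
  (forall k, measurable (h @^-1` [set k])) -> measurable A ->
  P A = (\sum_(k < m.+1) P (A `&` h @^-1` [set k]))%E.
Proof.
move=> mh mA; rewrite {1}(split_fibers h A) -measure_bigsetU_ord//=.
- by move=> k; exact: measurableI.
- apply/trivIsetP => /= i j _ _ ij; rewrite -subset0 => u [[_ /= ui] [_ /= uj]].
  by move: ij; rewrite -ui -uj eqxx.
Qed.

(** By [renewal], [kappa] has law [w] and, given its value, [tau] is again distributed as [P]. The
    digits of one point are then independent with law [w]. *)
Definition digit n u : 'I_m.+1 := kappa (iter n tau u).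

(** Stands for the sigma-algebra generated by the first [n] digits: as these take finitely many
    values, dependence on them alone already implies measurability. *)
Definition determined n (A : set Omega) := forall u v,
  (forall s, (s < n)%N -> digit s u = digit s v) -> A u -> A v.

(** What membership in [A] demands of [tau u] when the first digit of [u] is [k]. The existential
    spares the choice of a preimage under [tau]. *)
Let tail n (A : set Omega) k : set Omega :=
  [set v | exists u, [/\ A u, kappa u = k &
     forall s, (s < n)%N -> digit s (tau u) = digit s v]].

Let determined_tail n A k : determined n (tail n A k).
Proof.
move=> u v uv [z [Az kz zu]]; exists z; split => // s sn.
by rewrite zu// uv.
Qed.

Let determined_split n A k : determined n.+1 A ->
  A `&` kappa @^-1` [set k] = kappa @^-1` [set k] `&` tau @^-1` (tail n A k).
Proof.
move=> dA; apply/seteqP; split => [u [Au ku]|u [ku [z [Az kz zu]]]].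
  by split => //; exists u.
split => //; apply: (dA z) => // -[_|s sn]; first by rewrite /digit/= kz ku.
by rewrite /digit !iterSr; exact: zu.
Qed.

Lemma determined0 A : determined 0 A -> A = set0 \/ A = setT.
Proof.
move=> dA; have [[u Au]|nA] := pselect (exists u, A u).
  by right; apply/seteqP; split => // v _; exact: dA Au.
by left; rewrite -subset0 => u Au; apply: nA; exists u.
Qed.

Lemma determined_measurable n A : determined n A -> measurable A.
Proof.
elim: n A => [|n IH] A dA; first by case: (determined0 A dA) => ->.
rewrite (split_fibers kappa A); apply: bigsetU_measurable => k _.
rewrite (determined_split n A k dA); apply: measurableI => //.
rewrite -[X in measurable X]setTI; apply: mtau => //.
apply: IH; exact: determined_tail.
Qed.

Let measurable_iter n : measurable_fun setT (iter n tau).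
Proof.
elim: n => [|n IH]; first exact: measurable_id.
exact: (measurableT_comp mtau IH).
Qed.

(** Peeling off the first digit turns [A] into a condition on the first [n] digits of [tau u];
    [renewal] factors out the weight and the induction hypothesis handles the rest. *)
Lemma determined_independent n A B : determined n A -> measurable B ->
  P (A `&` iter n tau @^-1` B) = (P A * P B)%E.
Proof.
move=> + mB; elim: n A => [|n IH] A dA.
  case: (determined0 A dA) => ->; first by rewrite set0I measure0 mul0e.
  by rewrite setTI probability_setT mul1e.
have mA := determined_measurable _ _ dA.
have mT k := determined_measurable _ _ (determined_tail n A k).
have mBn j : measurable (iter j tau @^-1` B).
  by rewrite -[X in measurable X]setTI; exact: measurable_iter.
rewrite (probability_fibers kappa A)// ge0_sume_distrl; last by [].
rewrite (probability_fibers kappa)//; last exact: measurableI.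
apply: eq_bigr => k _.
rewrite setIAC (determined_split n A k dA) renewal//.
rewrite (_ : _ `&` _ = kappa @^-1` [set k] `&`
   tau @^-1` (tail n A k `&` iter n tau @^-1` B)); last first.
  rewrite preimage_setI setIA; congr (_ `&` _).
  by apply/funext => u; rewrite /preimage /mkset iterSr.
rewrite renewal; last exact: measurableI.
rewrite IH ?muleA//; exact: determined_tail.
Qed.

Lemma determined_sigma_algebra n : sigma_algebra setT (determined n).
Proof.
split.
- by move=> u v _.
- move=> A dA u v uv [_ nA]; split => // Av; apply: nA.
  by apply: (dA v) => // s sn; rewrite uv.
- by move=> F dF u v uv [j _ Fj]; exists j => //; exact: (dF j u).
Qed.

Lemma probability_digit n k : P (digit n @^-1` [set k]) = (w k)%:E.
Proof.
have := @determined_independent n setT (kappa @^-1` [set k]) (fun _ _ _ _ => I) (mkappa k).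
rewrite setTI probability_setT mul1e => ->.
by have := renewal k setT measurableT; rewrite preimage_setT setIT probability_setT mule1.
Qed.

Lemma determined_digit n A k : determined n A ->
  P (A `&` digit n @^-1` [set k]) = ((w k)%:E * P A)%E.
Proof.
move=> dA; rewrite muleC -(probability_digit 0 k).
exact: determined_independent.
Qed.

Lemma measurable_digit n k : measurable (digit n @^-1` [set k]).
Proof.
rewrite -[X in measurable X]setTI.
exact: (measurable_iter n measurableT (kappa @^-1` [set k])).
Qed.

End iterated_digits.

(** * The run driven by a sequence of digits *)

Section run_existence.
Context {R : realType} {d m : nat} {disp : measure_display}.
Context {Omega : measurableType disp} (P : probability Omega R).
Variables (w : 'I_m.+1 -> R) (kappa : Omega -> 'I_m.+1) (tau : Omega -> Omega).
Hypothesis w_ge0 : forall k, 0 <= w k.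
Hypothesis mkappa : forall k, measurable (kappa @^-1` [set k]).
Hypothesis mtau : measurable_fun setT tau.
Hypothesis renewal : forall k B, measurable B ->
  P (kappa @^-1` [set k] `&` tau @^-1` B) = ((w k)%:E * P B)%E.
Variables (eta : R) (x1 : 'rV[R]_d) (G : 'I_m.+1 -> 'rV[R]_d -> 'rV[R]_d).
Hypothesis mG : forall k, measurable_fun setT (G k).

Let dig := digit kappa tau.

(* The second component accumulates the squared gradients. *)
Fixpoint run_state t u : 'rV[R]_d * 'rV[R]_d :=
  if t is s.+1 then
    let a := (run_state s u).1 in let b := G (dig s u) a in
    let c := \row_i ((run_state s u).2 ord0 i + b ord0 i ^+ 2) in
    (\row_i (if b ord0 i == 0 then a ord0 i
             else a ord0 i - eta * (b ord0 i / Num.sqrt (c ord0 i))), c)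
  else (x1, 0).

(** States are numbered from 0 and times from 1: x_t depends on the digits of index below t - 1, and
    g_t uses digit t - 1 in addition. *)
Definition run_x t u := (run_state t.-1 u).1.
Definition run_g t u := G (dig t.-1 u) (run_x t u).

Lemma run_state2 t u i :
  (run_state t u).2 ord0 i = \sum_(1 <= s < t.+1) run_g s u ord0 i ^+ 2.
Proof.
elim: t => [|t IH]; first by rewrite big_geq// mxE.
by rewrite big_nat_recr//= mxE IH.
Qed.

Lemma run_recursion u : adagrad_recursion eta x1 (run_x ^~ u) (run_g ^~ u).
Proof.
split=> // -[//|t] i _.
rewrite /adagrad_denominator big_nat_recr//= -run_state2.
by rewrite {1}/run_x/= !mxE.
Qed.

Lemma run_state_determined t u v : (forall s, (s < t)%N -> dig s u = dig s v) ->
  run_state t u = run_state t v.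
Proof.
elim: t => //= t IH uv.
by rewrite (IH (fun s st => uv s (ltnW st))) (uv t (leqnn _)).
Qed.

Lemma history_determined t A : history run_x run_g t A ->
  determined kappa tau t.-1 A.
Proof.
apply: smallest_sub; first exact: determined_sigma_algebra.
rewrite subUset; split; apply: bigcup_sub => s /= /andP[s1 st] _ [B mB <-] u v uv [_ /= Bu].
  split => //=; rewrite /run_x -(@run_state_determined _ u)//.
  move=> r rs; apply: uv; apply: leq_trans rs _.
  by rewrite -!subn1 leq_sub2r.
have sE : (s.-1 < t.-1)%N by rewrite -ltnS !prednK// (leq_trans s1)// ltnW.
have stE : run_state s.-1 u = run_state s.-1 v.
  by apply: run_state_determined => r rs; apply: uv; exact: ltn_trans rs sE.
by split => //=; rewrite /run_g /run_x -stE /dig -uv.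
Qed.

Variable O : R.-pker 'rV[R]_d ~> 'rV[R]_d.
Hypothesis OE : forall v B, O v B = (\sum_k w k * \1_(G k @^-1` B) v)%:E.

(** Where digit t - 1 equals k, g_t is [G k] at x_t. The history and x_t are determined by the
    earlier digits, so fixing this digit multiplies probabilities by [w k]. *)
Lemma run_sampled : sampled_from_oracle P O run_x run_g.
Proof.
have dx t (B : set 'rV[R]_d) : determined kappa tau t.-1 (run_x t @^-1` B).
  by move=> u v uv; rewrite /= /run_x (@run_state_determined _ u v).
have dG t k (B : set 'rV[R]_d) :
    determined kappa tau t.-1 ((fun v => G k (run_x t v)) @^-1` B).
  exact: (dx t (G k @^-1` B)).
have dI n A B : determined kappa tau n A -> determined kappa tau n B ->
    determined kappa tau n (A `&` B).
  by move=> dA dB u v uv [Au Bu]; split; [exact: dA Au|exact: dB Bu].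
have dm n A : determined kappa tau n A -> measurable A.
  exact: determined_measurable.
have mx t : measurable_fun setT (run_x t).
  by move=> _ B mB; rewrite setTI; exact: dm (dx t B).
have mg t : (1 <= t)%N -> measurable_fun setT (run_g t).
  move=> t1 _ B mB; rewrite setTI; apply: (dm t) => u v uv.
  rewrite /= /run_g /run_x /dig uv ?prednK// (@run_state_determined _ u v)//.
  by move=> s st; apply: uv; apply: leq_trans st (leq_pred _).
move=> t t1; split; first exact: mg.
move=> A B /history_determined dA mB.
under eq_integral do rewrite OE.
rewrite (integral_mixture_weights P w G)//; last exact: dm dA.
have mgB : measurable (run_g t @^-1` B).
  by rewrite -[X in measurable X]setTI; exact: mg.
rewrite (probability_fibers P (dig t.-1)); last 2 first.
- by move=> k; exact: measurable_digit.
- by apply: measurableI => //; exact: dm dA.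
apply: eq_bigr => k _.
rewrite -(determined_digit _ _ _ _ mkappa mtau renewal _ _ _ (dI _ _ _ dA (dG t k B))).
congr (P _); apply/seteqP; split => u /= [[Au Bu] ku]; split => //; split => //.
  by rewrite -ku.
by rewrite /= /run_g /dig ku.
Qed.

Lemma run_exists : exists x g : nat -> Omega -> 'rV[R]_d, adagrad_run P eta x1 O x g.
Proof.
exists run_x, run_g; split; [exact: run_recursion|exact: run_sampled].
Qed.

End run_existence.

(** * Independent outcomes from one uniform point *)

Section unit_interval.
Context {R : realType}.

Definition unit_prob : set (measurableTypeR R) -> \bar R :=
  mrestr (@lebesgue_measure R) (measurable_itv `[0%R : R, 1%R[).

HB.instance Definition _ := Measure.on unit_prob.

Let unit_prob_setT : unit_prob setT = 1%E.
Proof. by rewrite /unit_prob /mrestr setTI lebesgue_measure_itv/= lte01 oppr0 adde0. Qed.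

HB.instance Definition _ := Measure_isProbability.Build _ _ R unit_prob unit_prob_setT.

Lemma lebesgue_measure_affine (a c : R) (B : set (measurableTypeR R)) :
  0 < a -> measurable B ->
  lebesgue_measure ((fun u : R => (u - c) / a) @^-1` B) =
  (a%:E * lebesgue_measure B)%E.
Proof.
move=> a0 mB.
pose h : measurableTypeR R -> measurableTypeR R := fun u => (u - c) / a.
have mh : measurable_fun setT h by apply: measurable_funM => //; apply: measurable_funB.
have ia0 : 0 <= a^-1 by rewrite invr_ge0 ltW.
pose law : {measure set (measurableTypeR R) -> \bar R} :=
  ltac:(refine (pushforward (@lebesgue_measure R) h); exact: mh).
rewrite [in RHS](@lebesgue_measure_unique _ (mscale (NngNum ia0) law)) //.
  by rewrite /= /mscale/= /pushforward muleA -EFinM divff ?gt_eqF// mul1e.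
move=> _ [[x y]] _ <-; rewrite /= /mscale/= /pushforward.
rewrite (_ : _ @^-1` _ = `]a * x + c, a * y + c]%classic); last first.
  apply/seteqP; split => u /=; rewrite !in_itv/= ltr_pdivlMr// ler_pdivrMr//
    ltrBrDr lerBlDr ![_ * a]mulrC//.
rewrite !lebesgue_measure_itv/= !lte_fin ltrD2r ltr_pM2l//.
case: ifPn => _; last by rewrite mule0.
rewrite -!EFinB -EFinM; congr _%:E.
by field; rewrite gt_eqF.
Qed.

Context {m : nat} (w : 'I_m.+1 -> R).
Hypotheses (w_ge0 : forall k, 0 <= w k) (w_sum1 : \sum_k w k = 1).

Definition cumulated n : R := \sum_(j < m.+1 | (j < n)%N) w j.

(** Outside [[0, 1[], a null set for [unit_prob], there is no cell and the value is [ord0]; hence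
    the extra piece in the preimage of [ord0]. *)
Definition cell_index (u : R) : 'I_m.+1 :=
  odflt ord0 [pick k : 'I_m.+1 | cumulated k <= u < cumulated k.+1].

(* Maps each cell, of length [w k], affinely onto [0, 1[: its iterates read off
   independent outcomes from a uniform point. *)
Definition cell_rescale (u : R) : R :=
  (u - cumulated (cell_index u)) / w (cell_index u).

Let cumulated0 : cumulated 0 = 0.
Proof. by rewrite /cumulated big_pred0. Qed.

Let cumulated_last : cumulated m.+1 = 1.
Proof. by rewrite -w_sum1; apply: eq_bigl => j; rewrite ltn_ord. Qed.

Let cumulatedS (k : 'I_m.+1) : cumulated k.+1 = cumulated k + w k.
Proof.
rewrite /cumulated (bigD1 k)//= addrC; congr (_ + _).
by apply: eq_bigl => j; rewrite ltnS [in RHS]ltn_neqAle andbC.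
Qed.

Let cumulated_le n p : (n <= p)%N -> cumulated n <= cumulated p.
Proof.
move=> np; rewrite /cumulated [leRHS](bigID (fun j : 'I_m.+1 => (j < n)%N))/=.
rewrite ler_wpDr ?sumr_ge0// le_eqVlt; apply/orP; left; apply/eqP.
by apply: eq_bigl => j; rewrite andb_idl// => /leq_trans; apply.
Qed.

Let cell_unique (j k : 'I_m.+1) (u : R) :
  cumulated j <= u < cumulated j.+1 -> cumulated k <= u < cumulated k.+1 -> j = k.
Proof.
move=> /andP[ju uj] /andP[ku uk]; apply/val_inj/eqP; rewrite eqn_leq.
apply/andP; split; rewrite leqNgt; apply/negP => /cumulated_le h.
  by have := lt_le_trans uk (le_trans h ju); rewrite ltxx.
by have := lt_le_trans uj (le_trans h ku); rewrite ltxx.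
Qed.

Let cell_indexE (k : 'I_m.+1) u : cumulated k <= u < cumulated k.+1 -> cell_index u = k.
Proof.
move=> ku; rewrite /cell_index; case: pickP => [j ju|/(_ k)]; last by rewrite ku.
exact: cell_unique ju ku.
Qed.

Let cell_indexP u : 0 <= u < 1 ->
  cumulated (cell_index u) <= u < cumulated (cell_index u).+1.
Proof.
move=> /andP[u0 u1]; suff [k ku] : exists k : 'I_m.+1, cumulated k <= u < cumulated k.+1.
  by rewrite (cell_indexE k u ku).
have : forall n, (n <= m.+1)%N -> u < cumulated n ->
    exists k : 'I_m.+1, cumulated k <= u < cumulated k.+1.
  elim=> [_|n IH nm]; first by rewrite cumulated0 ltNge u0.
  have [le ult|lt _] := leP (cumulated n) u; last exact: IH (ltnW nm) lt.
  by exists (Ordinal nm); rewrite /= le.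
by move=> /(_ m.+1 (leqnn _)); rewrite cumulated_last; apply.
Qed.

Let cell_index_out u : ~~ (0 <= u < 1) -> cell_index u = ord0.
Proof.
move=> u01; rewrite /cell_index; case: pickP => // k /andP[ku uk]; exfalso.
move: u01; rewrite (le_trans _ ku) ?(lt_le_trans uk)//.
  by rewrite -cumulated_last cumulated_le.
by rewrite -cumulated0 cumulated_le.
Qed.

Lemma measurable_cell_index k : measurable (cell_index @^-1` [set k]).
Proof.
rewrite (_ : _ @^-1` _ = `[cumulated k, cumulated k.+1[%classic `|`
    (if k == ord0 then ~` `[0, 1[%classic else set0)).
  by apply: measurableU => //; case: ifP => // _; exact: measurableC.
apply/seteqP; split => u /=.
- move=> uk; have [u01|u01] := boolP (0 <= u < 1).
    by left; rewrite in_itv/= -uk cell_indexP.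
  right; rewrite -uk cell_index_out// eqxx/= in_itv/=; exact/negP.
- rewrite in_itv/= => -[|]; first exact: cell_indexE.
  by case: eqP => // -> /=; rewrite in_itv/= => /negP; exact: cell_index_out.
Qed.

Lemma measurable_cell_rescale :
  measurable_fun (setT : set (measurableTypeR R)) (cell_rescale : _ -> measurableTypeR R).
Proof.
rewrite (_ : cell_rescale = fun u =>
   \sum_k \1_(cell_index @^-1` [set k]) u * ((u - cumulated k) / w k)).
  apply: measurable_sum => k; apply: measurable_funM.
    exact: (measurable_indic (measurable_cell_index k)).
  by apply: measurable_funM => //; apply: measurable_funB.
apply/funext => u; rewrite (bigD1 (cell_index u))//= big1 ?addr0.
  by rewrite indicE mem_set// mul1r.
move=> k ku; rewrite indicE memNset ?mul0r//= => uk.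
by move: ku; rewrite uk eqxx.
Qed.

Lemma cell_renewal k (B : set (measurableTypeR R)) : measurable B ->
  unit_prob (cell_index @^-1` [set k] `&` cell_rescale @^-1` B) =
  ((w k)%:E * unit_prob B)%E.
Proof.
move=> mB; rewrite /unit_prob /mrestr.
(* An outcome of weight 0 has an empty cell, so the division by [w k] is harmless on [[0, 1[]. *)
have [wk0|wk0] := eqVneq (w k) 0.
  rewrite wk0 mul0e (_ : _ `&` _ = set0) ?measure0//.
  rewrite -subset0 => u [[/= uk _]]; rewrite in_itv/= => /cell_indexP.
  by rewrite uk cumulatedS wk0 addr0 => /andP[/le_lt_trans h /h]; rewrite ltxx.
have wk : 0 < w k by rewrite lt_def wk0 w_ge0.
rewrite -(lebesgue_measure_affine (w k) (cumulated k))//; last exact: measurableI.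
congr (lebesgue_measure _); apply/seteqP; split => u /=.
- move=> [[uk uB]]; rewrite !in_itv/= => u01.
  have := cell_indexP u u01; rewrite /cell_rescale uk cumulatedS => /andP[ku uk'].
  rewrite /cell_rescale uk in uB; split => //.
  by rewrite divr_ge0 ?subr_ge0//= ltr_pdivrMr// mul1r ltrBlDl.
- rewrite !in_itv/= => -[uB /andP[]].
  rewrite pmulr_lge0 ?invr_gt0// subr_ge0 ltr_pdivrMr// mul1r ltrBlDl => ku uk.
  have ck : cell_index u = k by apply: cell_indexE; rewrite ku cumulatedS.
  split; first by split => //; rewrite /cell_rescale ck.
  rewrite (le_trans _ ku)/=; last by rewrite -cumulated0 cumulated_le.
  rewrite (lt_le_trans uk)// -cumulatedS -cumulated_last; exact: cumulated_le.
Qed.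

End unit_interval.

(** * The instance with abstract parameters *)

Section hard_instance.
Context {R : realType} {d m : nat}.
Variables (L sigma x1 : 'rV[R]_d) (Delta eta : R) (T : nat).
Variables (w : 'I_m.+1 -> R) (xi : 'I_m.+1 -> 'I_d -> bool).
Variables (eps M D : 'I_d -> R) (N : 'I_d -> nat).
Hypotheses (L_gt0 : forall i, 0 < L ord0 i) (eta_gt0 : 0 < eta) (T_gt0 : (1 <= T)%N).
Hypotheses (w_ge0 : forall k, 0 <= w k) (w_sum1 : \sum_k w k = 1).
Hypotheses (eps_ge0 : forall i, 0 <= eps i) (M_ge0 : forall i, 0 <= M i).
Hypothesis mean_xi : forall i, (\sum_k w k * (xi k i)%:R) * M i = eps i.
Hypothesis second_moment : forall i, M i * eps i - eps i ^+ 2 <= sigma ord0 i ^+ 2.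
Hypotheses (N_gt0 : forall i, (0 < N i)%N) (D_gt0 : forall i, 0 < D i).
Hypothesis N_large : forall i, 2 * (\sum_k w k * (xi k i)%:R) * T%:R <= (N i)%:R.
Hypothesis D_sum : \sum_i D i <= Delta.
Hypothesis eps_small : forall i,
  eps i ^+ 2 <= L ord0 i * D i * ln (N i)%:R / (8 * (N i)%:R).

Let phi i := coord_fun (eps i) (L ord0 i) eta (x1 ord0 i) (N i).
Let psi i := coord_grad (eps i) (L ord0 i) eta (x1 ord0 i) (N i).

Let is_derive_phi i (z : R) : is_derive z (1 : R) (phi i) (psi i z).
Proof. exact: is_derive_coord_fun. Qed.

Let psi_lipschitz i a b : `|psi i a - psi i b| <= L ord0 i * `|a - b|.
Proof. exact: coord_grad_lipschitz. Qed.

Let measurable_psi i : measurable_fun setT (psi i).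
Proof.
apply: measurable_funB => //; apply: measurable_funM => //.
elim: (N i) => [|n IH] /=.
  by apply: measurable_maxr => //; exact: measurable_funB.
by apply: measurable_minr => //; apply: measurableT_comp => //; exact: measurable_funB.
Qed.

Let G := noisy_grad psi eps M xi.

Let measurable_G k : measurable_fun setT (G k).
Proof. exact: measurable_noisy_grad. Qed.

(** The noiseless and the noisy instance differ only in their parameters. [N_large] and [eps_small]
    pull in opposite directions: [N i] must hold twice the expected number of moves, while the
    admissible slope shrinks like the root of ln N / N. *)
Lemma hard_instance :
  exists (f : 'rV[R]_d -> R) (O : R.-pker 'rV[R]_d ~> 'rV[R]_d),
    [/\ (forall x : 'rV[R]_d, differentiable f x),
        coordinate_smooth L f,
        initial_gap_le f x1 Delta,
        (exists (disp : measure_display) (Omega : measurableType disp)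
                (P : probability Omega R) (x g : nat -> Omega -> 'rV[R]_d),
            adagrad_run P eta x1 O x g) &
        forall (disp : measure_display) (Omega : measurableType disp)
               (P : probability Omega R) (x g : nat -> Omega -> 'rV[R]_d),
          adagrad_run P eta x1 O x g ->
          [/\ unbiased_gradients P f x g,
              variance_bounded_gradients P sigma f x g &
              ((2^-1 * \sum_i eps i)%:E
               <= 'E_P[fun w => min_grad_norm1 f T (x ^~ w)])%E]].
Proof.
have OE v B := mixtureE w G w_ge0 v B.
pose f := separable phi.
have gradE a i : grad f a ord0 i = psi i (a ord0 i) by exact: grad_separable.
have psi_point i k : (k <= N i)%N -> psi i (adagrad_point eta (x1 ord0 i) k) = - eps i.
  by move=> kN; exact: coord_grad_point.
exists f, (mixture_kernel w G w_ge0 w_sum1 measurable_G); split.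
- by move=> x; exact: (differentiable_separable _ _ is_derive_phi).
- by apply: (separable_smooth _ _ is_derive_phi) => i a b; exact: coord_fun_smooth.
- apply: (separable_gap _ D) D_sum => i; last exact: coord_fun_start.
  by move=> a; apply: coord_fun_lower_bound.
- exists _, (measurableTypeR R), unit_prob.
  apply: (run_exists unit_prob w (cell_index w) (cell_rescale w)).
  + exact: w_ge0.
  + exact: measurable_cell_index.
  + exact: measurable_cell_rescale.
  + exact: cell_renewal.
  + exact: measurable_G.
  + exact: OE.
- move=> disp Omega P x g run; split.
  + move=> t i t1.
    rewrite (_ : (fun v => grad f (x t v) ord0 i) = fun v => psi i (x t v ord0 i)).
      apply: (run_unbiased eta x1 psi eps M (fun i => L ord0 i) w xi) run _ _ _ => //.
    by apply/funext => v; rewrite gradE.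
  + move=> t i t1.
    rewrite (_ : (fun v => `|g t v ord0 i - grad f (x t v) ord0 i| ^+ 2) =
        fun v => `|g t v ord0 i - psi i (x t v ord0 i)| ^+ 2).
      apply: (run_variance eta x1 psi eps M (fun i => L ord0 i) w xi) run _ _ _ _ _ _ => //.
      exact: sqr_ge0.
    by apply/funext => v; rewrite gradE.
  + by apply: (expected_min_grad_norm1_ge eta x1 psi eps M w xi) run N psi_point f gradE T _ _ _.
Qed.

End hard_instance.

(** * Choice of the parameters *)

Section parameters.
Context {R : realType}.

Lemma powR_third_exp3 (a p : R) : 0 <= a -> (a `^ (p / 3)) ^+ 3 = a `^ p.
Proof.
move=> a0; rewrite -powR_mulrn ?powR_ge0// -powRrM; congr (_ `^ _).
by field.
Qed.

Lemma powR_quarter_exp4 (a : R) : 0 <= a -> (a ^+ 4) `^ (1 / 4) = a.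
Proof.
move=> a0; rewrite -powR_mulrn// -powRrM -[RHS]powRr1//; congr (_ `^ _).
by field.
Qed.

Lemma ln_le_sqrt (x : R) : 0 < x -> ln x <= 2 * Num.sqrt x.
Proof.
move=> x0; have s0 : 0 < Num.sqrt x by rewrite sqrtr_gt0.
rewrite -{1}(sqr_sqrtr (ltW x0)) expr2 lnM ?posrE//.
by have := ln_sublinear s0; lra.
Qed.

(* [s = sigma_i], [l = L_i], [a = sigma_i^(2/3) L_i^(1/3)], [A] is the sum of the
   [a]'s, and [q = 2 p T] is twice the expected number of moves. *)
Lemma stochastic_coordinate (a s l A Delta e C : R) (d T : nat) :
  0 < a -> 0 < s -> 0 < l -> 0 < A -> 0 < Delta -> 0 < e -> (0 < d)%N ->
  a ^+ 3 = s ^+ 2 * l -> e ^+ 4 = Delta * ln T%:R / (T%:R * A) ->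
  (1 <= T)%N -> 1 <= ln T%:R :> R ->
  C = a ^+ 4 * Delta / (64 * s ^+ 4 * A) ->
  C ^- 2 <= T%:R -> (C * d%:R ^+ 2 / 2) ^+ 2 <= T%:R ->
  let p := (a * e / 4) ^+ 2 / s ^+ 2 in
  let n := (Num.trunc (2 * p * T%:R)).+1 in
  p <= d%:R^-1 /\
  (a * e / 4) ^+ 2 <= l * (Delta * (a / A) / 2) * ln n%:R / (8 * n%:R).
Proof.
move=> a0 s0 l0 A0 D0 e0 d0 a3 e4 T1 lnT CE T_large1 T_large2 p n.
have T0 : 0 < T%:R :> R by rewrite ltr0n.
have d0' : 0 < d%:R :> R by rewrite ltr0n.
have C0 : 0 < C by rewrite CE divr_gt0 ?mulr_gt0 ?exprn_gt0.
have p0 : 0 < p by rewrite divr_gt0 ?exprn_gt0// divr_gt0 ?mulr_gt0.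
have p2 : p ^+ 2 = C * ln T%:R / (4 * T%:R).
  rewrite /p CE; transitivity (a ^+ 4 * e ^+ 4 / (256 * s ^+ 4)).
    by field; rewrite gt_eqF.
  by rewrite e4; field; rewrite !gt_eqF.
(* By [p2] and ln T <= 2 sqrt T, the square of [p] is at most of order C / sqrt T; [T_large2] is
   what brings it below 1 / d^2. *)
split.
  rewrite -(@ler_pXn2r _ 2) ?nnegrE ?invr_ge0 ?ler0n ?(ltW p0)// p2.
  have sT : 0 < Num.sqrt T%:R :> R by rewrite sqrtr_gt0.
  have H1 : C * d%:R ^+ 2 / 2 <= Num.sqrt T%:R.
    rewrite -(@ler_pXn2r _ 2) ?nnegrE ?(ltW sT)//; last first.
      by rewrite divr_ge0// mulr_ge0 ?exprn_ge0 ?(ltW C0).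
    by rewrite sqr_sqrtr// ltW.
  have H2 := ln_le_sqrt _ T0.
  rewrite ler_pdivrMr ?mulr_gt0// exprVn ler_pdivlMl ?exprn_gt0//.
  rewrite -[T%:R in leRHS](sqr_sqrtr (ltW T0)).
  have : C * d%:R ^+ 2 * ln T%:R <= C * d%:R ^+ 2 * (2 * Num.sqrt T%:R).
    by rewrite ler_wpM2l// mulr_ge0 ?exprn_ge0 ?(ltW C0).
  have : (C * d%:R ^+ 2 / 2) * Num.sqrt T%:R <= Num.sqrt T%:R * Num.sqrt T%:R.
    by rewrite ler_wpM2r// ltW.
  move: (ln _) (Num.sqrt _) => u v; rewrite -[v ^+ 2]/(v * v); lra.
set q := 2 * p * T%:R in n *.
have q0 : 0 < q by apply: mulr_gt0 => //; apply: mulr_gt0.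
(* The number of moves is at least the fourth root of [T], so its logarithm loses only a factor 4
   against ln T. *)
have q4 : T%:R <= q ^+ 4.
  have -> : q ^+ 4 = (C * T%:R * ln T%:R) ^+ 2.
    transitivity ((4 * p ^+ 2 * T%:R ^+ 2) ^+ 2); first by rewrite /q; ring.
    by rewrite p2; field; rewrite gt_eqF.
  have H1 : 1 <= C ^+ 2 * T%:R.
    by rewrite mulrC -ler_pdivrMr ?exprn_gt0// div1r.
  have H2 : C ^+ 2 * T%:R * T%:R <= (C * T%:R * ln T%:R) ^+ 2.
    have -> : C ^+ 2 * T%:R * T%:R = (C * T%:R) ^+ 2 by ring.
    have CT : 0 <= C * T%:R by rewrite mulr_ge0 ?ltW.
    have CTl : C * T%:R <= C * T%:R * ln T%:R by rewrite ler_peMr.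
    by rewrite ler_pXn2r ?nnegrE// (le_trans CT).
  have H3 : T%:R <= C ^+ 2 * T%:R * T%:R by rewrite ler_peMl// ltW.
  exact: le_trans H3 H2.
have q1 : 1 <= q.
  rewrite -(@ler_pXn2r _ 4) ?nnegrE ?(ltW q0)// expr1n.
  by apply: le_trans q4; rewrite ler1n.
have qn : q <= n%:R by rewrite ltW// truncnS_gt.
have nq : n%:R <= 2 * q.
  have : (Num.trunc q)%:R <= q by rewrite truncn_le ltW.
  by rewrite /n -natr1; lra.
have n0 : 0 < n%:R :> R by rewrite ltr0n.
have lnn : ln T%:R / 4 <= ln n%:R :> R.
  have : ln T%:R <= ln (q ^+ 4) :> R by rewrite ler_ln ?posrE ?exprn_gt0.
  have : ln q <= ln n%:R :> R by rewrite ler_ln ?posrE.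
  by rewrite lnXn//; lra.
rewrite ler_pdivlMr ?mulr_gt0//.
(* The denominator 4 in the slope is chosen to make this an equality, once [n] is replaced by its
   bound 2 q. *)
have E : (a * e / 4) ^+ 2 * (8 * (2 * q)) = l * (Delta * (a / A) / 2) * (ln T%:R / 4).
  rewrite /q /p.
  transitivity (a * a ^+ 3 * e ^+ 4 * T%:R / (8 * s ^+ 2)).
    by field; rewrite gt_eqF.
  by rewrite a3 e4; field; rewrite !gt_eqF.
apply: (@le_trans _ _ ((a * e / 4) ^+ 2 * (8 * (2 * q)))).
  by rewrite ler_wpM2l ?sqr_ge0// ler_wpM2l.
rewrite E ler_wpM2l// !mulr_ge0 ?invr_ge0 ?ltW//.
Qed.

End parameters.

(** A single outcome that always moves, with [M] equal to [eps], is noiseless and so meets every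
    variance bound. At most [T] moves occur, and [N] is their double as [hard_instance] demands. The
    factor 1 / 8 combines the 4 in the slope with the half lost there. *)
Lemma deterministic_instance {R : realType} {d : nat} (L sigma x1 : 'rV[R]_d)
    (Delta eta : R) (T : nat) :
  (1 <= d)%N -> (forall i, 0 < L ord0 i) -> 0 < Delta -> 0 < eta -> (1 <= T)%N ->
  exists (f : 'rV[R]_d -> R) (O : R.-pker 'rV[R]_d ~> 'rV[R]_d),
    [/\ (forall x : 'rV[R]_d, differentiable f x),
        coordinate_smooth L f,
        initial_gap_le f x1 Delta,
        (exists (disp : measure_display) (Omega : measurableType disp)
                (P : probability Omega R) (x g : nat -> Omega -> 'rV[R]_d),
            adagrad_run P eta x1 O x g) &
        forall (disp : measure_display) (Omega : measurableType disp)
               (P : probability Omega R) (x g : nat -> Omega -> 'rV[R]_d),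
          adagrad_run P eta x1 O x g ->
          [/\ unbiased_gradients P f x g,
              variance_bounded_gradients P sigma f x g &
              ((8^-1 * Num.sqrt (norm1 L * Delta * ln T%:R / T%:R))%:E
               <= 'E_P[fun w => min_grad_norm1 f T (x ^~ w)])%E]].
Proof.
move=> d1 L0 D0 eta0 T1.
have T0 : 0 < T%:R :> R by rewrite ltr0n.
have lnT0 : 0 <= ln T%:R :> R by rewrite ln_ge0// ler1n.
set S := norm1 L.
have SE : S = \sum_i L ord0 i.
  by apply: eq_bigr => i _; rewrite ger0_norm// ltW.
have S0 : 0 < S.
  rewrite SE (bigD1 (Ordinal d1))//= ltr_wpDr// sumr_ge0// => i _.
  exact: ltW.
pose e := Num.sqrt (Delta * ln T%:R / (T%:R * S)).
have e0 : 0 <= e by exact: sqrtr_ge0.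
have e2 : e ^+ 2 = Delta * ln T%:R / (T%:R * S).
  by rewrite sqr_sqrtr// divr_ge0 ?mulr_ge0// ltW.
pose eps i := L ord0 i * e / 4.
have eps0 i : 0 <= eps i by rewrite divr_ge0// mulr_ge0// ltW.
have -> : 8^-1 * Num.sqrt (S * Delta * ln T%:R / T%:R) = 2^-1 * \sum_i eps i.
  have -> : S * Delta * ln T%:R / T%:R = (S * e) ^+ 2.
    by rewrite exprMn e2; field; rewrite !gt_eqF.
  rewrite sqrtr_sqr ger0_norm; last by rewrite mulr_ge0// ltW.
  rewrite /eps -!mulr_suml -SE; by field.
have w1 : \sum_(k < 1) 1 = 1 :> R by rewrite big_ord_recl big_ord0 addr0.
apply: (@hard_instance _ _ 0 L sigma x1 Delta eta T (fun=> 1) (fun _ _ => true)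
   eps eps (fun i => Delta * (L ord0 i / S)) (fun=> (2 * T)%N)) => //.
- by move=> i; rewrite big_ord_recl big_ord0 addr0 !mul1r.
- by move=> i; rewrite -expr2 subrr sqr_ge0.
- by rewrite muln_gt0.
- by move=> i; rewrite mulr_gt0// divr_gt0.
- by move=> i; rewrite big_ord_recl big_ord0 addr0 !mulr1 natrM.
- by rewrite -mulr_sumr -mulr_suml -SE divff ?gt_eqF// mulr1.
- move=> i; rewrite natrM /eps.
  have -> : (L ord0 i * e / 4) ^+ 2 =
      L ord0 i * (Delta * (L ord0 i / S)) * ln T%:R / (8 * (2 * T%:R)).
    transitivity (L ord0 i ^+ 2 * e ^+ 2 / 16); first by field.
    by rewrite e2; field; rewrite !gt_eqF.
  rewrite ler_pM2r; last by rewrite invr_gt0 !mulr_gt0.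
  have Li := L0 i; rewrite ler_pM2l; last by rewrite !mulr_gt0// invr_gt0.
  by rewrite ler_ln ?posrE ?mulr_gt0// ler_peMl ?ler1n// ltW.
Qed.

Lemma stochastic_instance {R : realType} {d : nat} (L sigma : 'rV[R]_d)
    (Delta : R) :
  (1 <= d)%N -> (forall i, 0 < L ord0 i) -> (forall i, 0 <= sigma ord0 i) ->
  0 < Delta ->
  0 < \sum_(i < d) sigma ord0 i `^ (2 / 3) * L ord0 i `^ (1 / 3) ->
  exists T0 : nat, forall (x1 : 'rV[R]_d) (eta : R) (T : nat),
    0 < eta -> (T0 <= T)%N ->
  exists (f : 'rV[R]_d -> R) (O : R.-pker 'rV[R]_d ~> 'rV[R]_d),
    [/\ (forall x : 'rV[R]_d, differentiable f x),
        coordinate_smooth L f,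
        initial_gap_le f x1 Delta,
        (exists (disp : measure_display) (Omega : measurableType disp)
                (P : probability Omega R) (x g : nat -> Omega -> 'rV[R]_d),
            adagrad_run P eta x1 O x g) &
        forall (disp : measure_display) (Omega : measurableType disp)
               (P : probability Omega R) (x g : nat -> Omega -> 'rV[R]_d),
          adagrad_run P eta x1 O x g ->
          [/\ unbiased_gradients P f x g,
              variance_bounded_gradients P sigma f x g &
              ((8^-1 * ((\sum_(i < d) sigma ord0 i `^ (2 / 3) *
                                  L ord0 i `^ (1 / 3)) ^+ 3
                    * Delta * ln T%:R / T%:R) `^ (1 / 4))%:E
               <= 'E_P[fun w => min_grad_norm1 f T (x ^~ w)])%E]].
Proof.
move=> d1 L0 sigma0 D0.
pose a i := sigma ord0 i `^ (2 / 3) * L ord0 i `^ (1 / 3).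
rewrite -/(\sum_i a i); set A := \sum_i a i => A0.
pose C i := a i ^+ 4 * Delta / (64 * sigma ord0 i ^+ 4 * A).
(* The first threshold makes ln N_i comparable with ln T, the second gives p_i <= 1 / d. For sigma_i
   = 0 the constant [C i] is 0 by the convention on division, and both are trivial. *)
pose T0 i := ((Num.trunc (C i ^- 2)).+1 + (Num.trunc ((C i * d%:R ^+ 2 / 2) ^+ 2)).+1)%N.
exists (\sum_i T0 i + (Num.trunc (expR 1 : R)).+1)%N => x1 eta T eta0 TT.
have T_exp : expR 1 <= T%:R :> R.
  apply: (@le_trans _ _ (Num.trunc (expR 1 : R)).+1%:R); first exact/ltW/truncnS_gt.
  by rewrite ler_nat; apply: leq_trans TT; exact: leq_addl.
have T0' : 0 < T%:R :> R by apply: lt_le_trans T_exp; exact: expR_gt0.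
have T1 : (1 <= T)%N by rewrite -(ltr0n R).
have lnT : 1 <= ln T%:R :> R by rewrite -[leLHS](expRK (R := R)) ler_ln ?posrE ?expR_gt0.
have lnT0 : 0 < ln T%:R :> R by apply: lt_le_trans lnT.
have TTi i : (T0 i <= T)%N.
  apply: leq_trans TT; apply: leq_trans (leq_addr _ _).
  by rewrite (bigD1 i)//= leq_addr.
have a_ge0 i : 0 <= a i by rewrite mulr_ge0 ?powR_ge0.
have a3 i : a i ^+ 3 = sigma ord0 i ^+ 2 * L ord0 i.
  rewrite exprMn !powR_third_exp3// ?(ltW (L0 i))// powRr1 ?(ltW (L0 i))//.
  by rewrite -[2%R]/(2%:R) powR_mulrn.
pose e := Num.sqrt (Num.sqrt (Delta * ln T%:R / (T%:R * A))).
have inner0 : 0 < Delta * ln T%:R / (T%:R * A) by rewrite divr_gt0 ?mulr_gt0.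
have e0 : 0 < e by rewrite !sqrtr_gt0.
have e4 : e ^+ 4 = Delta * ln T%:R / (T%:R * A).
  by rewrite (exprM e 2 2) !sqr_sqrtr ?sqrtr_ge0// ltW.
(* By the choice of [e], the slopes add up to a quarter of the fourth root in the claim. *)
pose eps i := a i * e / 4.
have eps0 i : 0 <= eps i by rewrite divr_ge0// mulr_ge0// ltW.
pose p i := eps i ^+ 2 / sigma ord0 i ^+ 2.
have p0 i : 0 <= p i by rewrite divr_ge0 ?sqr_ge0.
pose N i := (Num.trunc (2 * p i * T%:R)).+1.
(* The second half of the budget only keeps [D i] positive when [sigma_i = 0]. *)
pose D i := Delta * (a i / A) / 2 + Delta / d%:R / 2.
have d0 : 0 < d%:R :> R by rewrite ltr0n.
have Daux0 i : 0 <= Delta * (a i / A) / 2.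
  by rewrite divr_ge0// mulr_ge0 ?divr_ge0// ltW.
have Di0 i : 0 < D i by rewrite ltr_wpDl// !divr_gt0.
have noiseless i : sigma ord0 i = 0 -> eps i = 0.
  move=> s0; rewrite /eps /a s0 powR0 ?mul0r// mulf_neq0 ?invr_eq0//.
have coord i : p i <= d%:R^-1 /\
    eps i ^+ 2 <= L ord0 i * D i * ln (N i)%:R / (8 * (N i)%:R).
  have [s0|sn0] := eqVneq (sigma ord0 i) 0.
    rewrite /p (noiseless i s0) expr0n/= mul0r invr_ge0 ler0n; split => //.
    by rewrite divr_ge0 ?mulr_ge0 ?ln_ge0 ?ler1n ?ltW.
  have s0 : 0 < sigma ord0 i by rewrite lt_def sn0 sigma0.
  have ai : 0 < a i by rewrite mulr_gt0 ?powR_gt0.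
  have Tbig1 : C i ^- 2 <= T%:R.
    apply: le_trans (ltW (truncnS_gt _)) _; rewrite ler_nat.
    by apply: leq_trans (TTi i); exact: leq_addr.
  have Tbig2 : (C i * d%:R ^+ 2 / 2) ^+ 2 <= T%:R.
    apply: le_trans (ltW (truncnS_gt _)) _; rewrite ler_nat.
    by apply: leq_trans (TTi i); exact: leq_addl.
  have [pd epsN] := stochastic_coordinate _ _ _ _ _ _ _ d T ai s0 (L0 i)
    A0 D0 e0 d1 (a3 i) e4 T1 lnT erefl Tbig1 Tbig2.
  split => //; apply: le_trans epsN _.
  rewrite ler_pM2r ?invr_gt0 ?mulr_gt0 ?ltr0n// ler_wpM2r ?ln_ge0 ?ler1n//.
  by rewrite ler_pM2l// lerDl !divr_ge0 ?ltW.
have p_sum : \sum_i p i <= 1.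
  apply: (@le_trans _ _ (\sum_(i < d) d%:R^-1)).
    by apply: ler_sum => i _; case: (coord i).
  by rewrite sumr_const card_ord -[leLHS]mulr_natr mulVf ?gt_eqF.
(* For sigma_i = 0 the numerator and the denominator vanish, so [M i] is 0 and coordinate i receives
   no noise. *)
pose M i := eps i / p i.
have M_mean i : p i * M i = eps i.
  have [s0|sn0] := eqVneq (sigma ord0 i) 0.
    by rewrite /M (noiseless i s0) mul0r mulr0.
  rewrite /M mulrCA divff ?mulr1//.
  have s0 : 0 < sigma ord0 i by rewrite lt_def sn0 sigma0.
  have ai : 0 < a i by rewrite mulr_gt0 ?powR_gt0.
  by rewrite gt_eqF// /p divr_gt0 ?exprn_gt0// /eps divr_gt0// mulr_gt0.
(* Mutually exclusive outcomes: [ord0] hits no coordinate, each of the [d] others exactly one. *)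
pose w (k : 'I_d.+1) := if unlift ord0 k is Some i then p i else 1 - \sum_i p i.
pose xi (k : 'I_d.+1) i := k == lift ord0 i.
have w_xi i : \sum_k w k * (xi k i)%:R = p i.
  rewrite (bigD1 (lift ord0 i))//= /xi eqxx mulr1 /w liftK big1 ?addr0// => k.
  by move=> /negPf ->; rewrite mulr0.
have -> : 8^-1 * (A ^+ 3 * Delta * ln T%:R / T%:R) `^ (1 / 4) = 2^-1 * \sum_i eps i.
  have -> : A ^+ 3 * Delta * ln T%:R / T%:R = (A * e) ^+ 4.
    by rewrite exprMn e4; field; rewrite !gt_eqF.
  rewrite powR_quarter_exp4; last by rewrite mulr_ge0 ?ltW.
  by rewrite /eps -!mulr_suml -/A; field.
apply: (@hard_instance _ _ d L sigma x1 Delta eta T w xi eps M D N) => //.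
- by move=> k; rewrite /w; case: unliftP => // _; rewrite subr_ge0.
- rewrite big_ord_recl {1}/w unlift_none [X in _ + X](eq_bigr p) ?subrK// => i _.
  by rewrite /w liftK.
- by move=> i; rewrite divr_ge0.
- by move=> i; rewrite w_xi.
- move=> i; rewrite lerBlDr.
  apply: (@le_trans _ _ (sigma ord0 i ^+ 2)); last by rewrite lerDl sqr_ge0.
  have [s0|sn0] := eqVneq (sigma ord0 i) 0.
    by rewrite (noiseless i s0) mulr0 sqr_ge0.
  have s0 : 0 < sigma ord0 i by rewrite lt_def sn0 sigma0.
  have ei : 0 < eps i by rewrite /eps divr_gt0// !mulr_gt0 ?powR_gt0.
  by rewrite le_eqVlt /M /p; apply/orP; left; apply/eqP; field; rewrite !gt_eqF.
- by move=> i; rewrite w_xi ltW// truncnS_gt.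
- rewrite big_split/= -!mulr_suml -mulr_sumr -mulr_suml -/A divff ?gt_eqF// mulr1.
  by rewrite sumr_const card_ord -[Delta *+ d]mulr_natr mulfK ?gt_eqF//; lra.
- by move=> i; case: (coord i).
Qed.

Theorem theorem3p2 (R : realType) :
  exists c : R, 0 < c /\
  forall (d : nat) (L sigma : 'rV[R]_d) (Delta : R),
    (1 <= d)%N ->
    (forall i : 'I_d, 0 < L ord0 i) ->
    (forall i : 'I_d, 0 <= sigma ord0 i) ->
    0 < Delta ->
  exists T0 : nat,
  forall (x1 : 'rV[R]_d) (eta : R) (T : nat),
    0 < eta -> (T0 <= T)%N ->
  exists (f : 'rV[R]_d -> R) (O : R.-pker 'rV[R]_d ~> 'rV[R]_d),
    [/\ (forall x : 'rV[R]_d, differentiable f x),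
        coordinate_smooth L f,
        initial_gap_le f x1 Delta,
        (exists (disp : measure_display) (Omega : measurableType disp)
                (P : probability Omega R) (x g : nat -> Omega -> 'rV[R]_d),
            adagrad_run P eta x1 O x g) &
        forall (disp : measure_display) (Omega : measurableType disp)
               (P : probability Omega R) (x g : nat -> Omega -> 'rV[R]_d),
          adagrad_run P eta x1 O x g ->
          [/\ unbiased_gradients P f x g,
              variance_bounded_gradients P sigma f x g &
              ((c * Num.max
                  (Num.sqrt (norm1 L * Delta * ln T%:R / T%:R))
                  (((\sum_(i < d) sigma ord0 i `^ (2 / 3) *
                                  L ord0 i `^ (1 / 3)) ^+ 3
                    * Delta * ln T%:R / T%:R) `^ (1 / 4)))%:E
               <= 'E_P[fun w => min_grad_norm1 f T (x ^~ w)])%E]].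
Proof.
exists 8^-1; split; first by rewrite invr_gt0.
move=> d L sigma Delta d1 L0 sigma0 D0.
set A := \sum_(i < d) sigma ord0 i `^ (2 / 3) * L ord0 i `^ (1 / 3).
have A_ge0 : 0 <= A by apply: sumr_ge0 => i _; rewrite mulr_ge0 ?powR_ge0.
(* Here the second term of the maximum is 0, and the noiseless instance suffices. *)
have [A0|An0] := eqVneq A 0.
  exists 1%N => x1 eta T eta0 T1.
  rewrite A0 expr0n/= !mul0r powR0 ?mulf_neq0 ?invr_eq0//.
  rewrite max_l ?sqrtr_ge0//; exact: deterministic_instance.
have A0 : 0 < A by rewrite lt_def An0.
have [T0 stoch] := stochastic_instance L sigma Delta d1 L0 sigma0 D0 A0.
(* The successor ensures that [T] is positive, as the noiseless instance requires. *)
exists T0.+1 => x1 eta T eta0 T0T.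
(* The function may depend on [T], so one instance is taken according to which term is larger. *)
rewrite maxEge; case: ifP => _; last exact: stoch (ltnW T0T).
apply: deterministic_instance => //; exact: leq_ltn_trans T0T.
Qed.
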